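(* There exist constants $c_1,c_2>0$ and, for each $\epsilon\in(0,1/2)$, a constant $c_3(\epsilon)>0$ such that the following holds. Let $\epsilon\in(0,1/2)$, let $n\leq(1/2-\epsilon)\binom{d+1}{2}$, and let $A_1,\ldots,A_n\in\mathbb{R}^{d\times d}$ be independent random matrices, each $A_i$ being a Gaussian random matrix with i.i.d. entries of mean zero and variance $\tfrac1n$. Let $\mathcal{B}:\mathbb{S}^d\to\mathbb{R}^{n+1}$ be the linear map $\mathcal{B}(X)=(\mathrm{tr}(A_1X),\ldots,\mathrm{tr}(A_nX),\mathrm{tr}(X))$. Then for $k=\lfloor\tfrac{c_1n}{d}\rfloor$, the cone $\mathcal{B}(\mathbb{S}^d_+)\subset\mathbb{R}^{n+1}$ is $k$-Terracini convex with probability greater than $1-2e^{-c_2n}-e^{-c_3(\epsilon)n}$.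
   Context: $\mathbb{S}^d$ is the space of $d\times d$ real symmetric matrices and $\mathbb{S}^d_+$ the cone of positive semidefinite ones. $k$-Terracini convexity: for a closed, pointed ($\mathcal{C}\cap(-\mathcal{C})=\{0\}$), convex cone $\mathcal{C}$ and $x\in\mathcal{C}$, let $\mathcal{T}_{\mathcal{C}}(x)=\overline{\mathrm{cone}\{z-x:z\in\mathcal{C}\}}$ be the tangent cone and $\mathcal{L}_{\mathcal{C}}(x)=\mathcal{T}_{\mathcal{C}}(x)\cap(-\mathcal{T}_{\mathcal{C}}(x))$ the convex tangent space. $\mathcal{C}$ is $k$-Terracini convex if $\mathcal{L}_{\mathcal{C}}\big(\sum_{i=1}^kx^{(i)}\big)=\sum_{i=1}^k\mathcal{L}_{\mathcal{C}}(x^{(i)})$ for any collection $x^{(1)},\ldots,x^{(k)}$ of (not necessarily distinct) generators of extreme rays of $\mathcal{C}$. *)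

(* Defs.v *)
From HB Require Import structures.
From mathcomp Require Import all_boot all_order all_algebra.
From mathcomp Require Import all_classical all_reals all_analysis.

Set Implicit Arguments.
Unset Strict Implicit.
Unset Printing Implicit Defensive.

Import Order.TTheory GRing.Theory Num.Theory.
Import numFieldNormedType.Exports.

Local Open Scope classical_set_scope.
Local Open Scope ring_scope.

Section Cones.
Context {R : realType} {V : normedModType R}.
Implicit Types (C S : set V) (x y z : V).

Definition convex_cone C : Prop :=
  [/\ C 0, convex_set (C : set (convex_lmodType V))
    & forall (a : R) x, 0 <= a -> C x -> C (a *: x)].

Definition pointed_cone C : Prop := C `&` [set - x | x in C] = [set 0].

(* cone S: all finite nonnegative combinations of elements of S; the empty
   combination puts 0 in it. *)
Definition conic_hull S : set V :=
  [set y | exists m (a : 'I_m -> R) (s : 'I_m -> V),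
     [/\ forall i, 0 <= a i, forall i, S (s i) & y = \sum_(i < m) a i *: s i]].

Definition tangent_cone C x : set V := closure (conic_hull [set z - x | z in C]).

Definition convex_tangent_space C x : set V :=
  tangent_cone C x `&` [set - y | y in tangent_cone C x].

Definition ray x : set V := [set a *: x | a in [set a : R | 0 <= a]].

(* x generates an extreme ray of C: x is a nonzero element of C and the ray
   spanned by x is a face of C. *)
Definition extreme_ray_generator C x : Prop :=
  [/\ C x, x != 0
    & forall y z, C y -> C z -> ray x (y + z) -> ray x y /\ ray x z].

Definition minkowski_sum k (S : 'I_k -> set V) : set V :=
  [set \sum_(i < k) v i | v in [set v : 'I_k -> V | forall i, S i (v i)]].

(* The notion is defined for closed pointed convex cones only, so these
   requirements are part of the predicate. *)
Definition terracini_convex (k : nat) C : Prop :=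
  [/\ closed C, convex_cone C, pointed_cone C
    & forall x : 'I_k -> V, (forall i, extreme_ray_generator C (x i)) ->
        convex_tangent_space C (\sum_(i < k) x i) =
        minkowski_sum (fun i => convex_tangent_space C (x i))].

End Cones.

Section SymmetricMatrices.
Context {R : realType}.

Definition psd_cone (d : nat) : set 'M[R]_d :=
  [set X | X^T = X /\ forall v : 'cV[R]_d, 0 <= (v^T *m X *m v) 0 0].

(* The map X |-> (tr (A_1 X), ..., tr (A_n X), tr X), written on all of 'M_d;
   it is only ever applied to symmetric X. *)
Definition trace_map (n d : nat) (A : 'I_n -> 'M[R]_d) (X : 'M[R]_d) :
    'rV[R]_(n + 1) :=
  row_mx (\row_(i < n) \tr (A i *m X)) (\row_(_ < 1) \tr X).

End SymmetricMatrices.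

Arguments psd_cone {R} d _.

Section RandomMatrices.
Context {disp : measure_display} {T : measurableType disp} {R : realType}.
Variable P : probability T R.

(* Mutual independence of a finite family F of classes of events. *)
Definition independent (I : finType) (F : I -> set (set T)) : Prop :=
  forall (J : {set I}) (E : I -> set T), (forall i, i \in J -> F i (E i)) ->
    P (\bigcap_(i in [set` J]) E i) = (\prod_(i in J) P (E i))%E.

(* A random matrix is given by its entries, which are random variables. *)
Definition random_matrix (d : nat) := 'I_d -> 'I_d -> {RV P >-> R}.

Definition sample (d : nat) (A : random_matrix d) (w : T) : 'M[R]_d :=
  \matrix_(a, b) A a b w.

(* The sigma-algebra generated by a random matrix. *)
Definition sigma_matrix (d : nat) (A : random_matrix d) : set (set T) :=
  <<s \bigcup_(ab in [set: 'I_d * 'I_d])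
        g_sigma_algebra_preimage (A ab.1 ab.2) >>.

(* i.i.d. entries N(0, sigma2); the second argument of normal_prob is the
   standard deviation. *)
Definition gaussian_matrix (d : nat) (sigma2 : R) (A : random_matrix d) : Prop :=
  independent (fun ab : 'I_d * 'I_d => g_sigma_algebra_preimage (A ab.1 ab.2))
  /\ forall a b (U : set R), measurable U ->
       distribution P (A a b) U = normal_prob 0 (Num.sqrt sigma2) U.

(* The event G need not be measurable a priori, so the lower bound is asked of
   some measurable event that it contains. *)
Definition probability_gt (G : set T) (p : R) : Prop :=
  exists E : set T, [/\ measurable E, E `<=` G & (p%:E < P E)%E].

End RandomMatrices.

(* Main.v *)
Require Import Defs.
From mathcomp Require Import all_boot all_order all_algebra.
From mathcomp Require Import all_classical all_reals all_analysis.
From mathcomp Require Import measurable_realfun ring lra zify.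

Set Implicit Arguments.
Unset Strict Implicit.
Unset Printing Implicit Defensive.

Import Order.TTheory GRing.Theory Num.Theory.
Import numFieldNormedType.Exports.

Local Open Scope classical_set_scope.
Local Open Scope ring_scope.

(* Write calA N for the row of the numbers tr (A_i N).  Let X = V V^T have rank
   at most k.  The tangent space of the image cone at the image of X is the
   image of the tangent space {V G^T + G V^T} of the psd cone at X as soon as
     |M| <= K (|calA M| + |tr M|)
   for all symmetric M that are psd on the orthogonal complement of the columns
   of V: if M and M' are admissible directions whose images are close to z and
   -z, then M + M' is small, hence so are the psd compressions of M and M' to
   that complement, and M is close to the tangent space.  Since these tangent
   spaces add up along a sum of rank one matrices, so do their images.

   To prove the inequality, write M = N + T with N of rank at most 2k and T the
   compression, whose trace is at most |tr M| + sqrt k |M|.  Maurey's empirical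
   method replaces T by a sum of O(k) matrices of rank one, so it is enough that
   calA is bounded above and below on matrices of rank O(k).  For Gaussian A_i
   and k d <= c n this follows from tail bounds and nets.  A matrix of rank r is
   X Y with X^T X idempotent; X runs over a net for the operator norm and Y over
   a net for the Frobenius norm, both of size exp (O(d r)). *)

(** * Frobenius norm, orthogonalisation, and factorisation of psd matrices *)

Section Frobenius.
Context {R : realType}.

(** The obstacle is that admissible directions have arbitrary rank, while Gaussian measurements
    control only ranks O(n / d). The extra coordinate tr X makes up for this: a psd matrix T of
    trace s is s times a convex combination of rank one matrices of norm 1. The form |calA N|^2 -
    a^2 |N|^2 is nonnegative at low rank, and replacing T by the average of m random terms changes
    it in mean only by a variance, at most s^2 (a^2 + b^2) / m. As s^2 <= 2 (tr M)^2 + 2 k |M|^2,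
    taking m = mu k with a fixed mu lets this be absorbed. Every rank that occurs is then at most
    (mu + 2) k, which dictates c1. Since the trace dominates the norm on psd matrices, the same
    coordinate makes the image cone closed and pointed.

    Chance enters only through the event that calA is bounded above and below at low rank; it fails
    with probability at most 2 exp (- n / 64), whence c2. The term with c3 turns the weak inequality
    into a strict one. *)

Definition mxdot p q (M N : 'M[R]_(p, q)) : R := \tr (M^T *m N).
Definition fnorm p q (M : 'M[R]_(p, q)) : R := Num.sqrt (mxdot M M).

Lemma mxdotE p q (M N : 'M[R]_(p, q)) :
  mxdot M N = \sum_i \sum_j M i j * N i j.
Proof.
rewrite /mxdot /mxtrace exchange_big /=; apply: eq_bigr => j _.
by rewrite mxE; apply: eq_bigr => i _; rewrite mxE.
Qed.

Lemma mxdotC p q (M N : 'M[R]_(p, q)) : mxdot M N = mxdot N M.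
Proof. by rewrite /mxdot -mxtrace_tr trmx_mul trmxK. Qed.

Lemma mxdotDr p q (M N N' : 'M[R]_(p, q)) :
  mxdot M (N + N') = mxdot M N + mxdot M N'.
Proof. by rewrite /mxdot mulmxDr raddfD. Qed.

Lemma mxdotZr p q a (M N : 'M[R]_(p, q)) : mxdot M (a *: N) = a * mxdot M N.
Proof. by rewrite /mxdot -scalemxAr linearZ. Qed.

Lemma mxdotDl p q (M N N' : 'M[R]_(p, q)) :
  mxdot (N + N') M = mxdot N M + mxdot N' M.
Proof. by rewrite !(mxdotC _ M) mxdotDr. Qed.

Lemma mxdotZl p q a (M N : 'M[R]_(p, q)) : mxdot (a *: N) M = a * mxdot N M.
Proof. by rewrite !(mxdotC _ M) mxdotZr. Qed.

Lemma mxdot_ge0 p q (M : 'M[R]_(p, q)) : 0 <= mxdot M M.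
Proof.
rewrite mxdotE; apply: sumr_ge0 => i _; apply: sumr_ge0 => j _.
by rewrite -expr2 sqr_ge0.
Qed.

Lemma fnorm_ge0 p q (M : 'M[R]_(p, q)) : 0 <= fnorm M.
Proof. exact: sqrtr_ge0. Qed.

Lemma sqr_fnorm p q (M : 'M[R]_(p, q)) : fnorm M ^+ 2 = mxdot M M.
Proof. by rewrite sqr_sqrtr // mxdot_ge0. Qed.

Lemma fnorm_entry p q (M : 'M[R]_(p, q)) i j : `|M i j| <= fnorm M.
Proof.
rewrite -(@ler_pXn2r _ 2) ?nnegrE ?fnorm_ge0 // sqr_fnorm mxdotE.
rewrite (bigD1 i) //= (bigD1 j) //= real_normK ?num_real // -expr2 -addrA.
rewrite lerDl addr_ge0 ?sumr_ge0 // => *; rewrite ?sumr_ge0 // => *;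
by rewrite -expr2 sqr_ge0.
Qed.

Lemma fnorm0_eq0 p q (M : 'M[R]_(p, q)) : fnorm M = 0 -> M = 0.
Proof.
move=> M0; apply/matrixP => i j; rewrite mxE; apply/eqP; rewrite -normr_le0.
by rewrite -M0 fnorm_entry.
Qed.

Lemma fnorm0 p q : fnorm (0 : 'M[R]_(p, q)) = 0.
Proof. by rewrite /fnorm /mxdot mulmx0 mxtrace0 sqrtr0. Qed.

Lemma mxdot0_eq0 p q (M : 'M[R]_(p, q)) : mxdot M M = 0 -> M = 0.
Proof. by move=> M0; apply: fnorm0_eq0; rewrite /fnorm M0 sqrtr0. Qed.

Lemma fnormZ p q a (M : 'M[R]_(p, q)) : fnorm (a *: M) = `|a| * fnorm M.
Proof.
rewrite /fnorm mxdotZl mxdotZr mulrA -expr2 sqrtrM ?sqr_ge0 //.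
by rewrite sqrtr_sqr.
Qed.

Lemma fnormN p q (M : 'M[R]_(p, q)) : fnorm (- M) = fnorm M.
Proof. by rewrite -scaleN1r fnormZ normrN1 mul1r. Qed.

Lemma sqr_fnormD p q (M N : 'M[R]_(p, q)) :
  fnorm (M + N) ^+ 2 = fnorm M ^+ 2 + 2 * mxdot M N + fnorm N ^+ 2.
Proof. by rewrite !sqr_fnorm !(mxdotDl, mxdotDr) (mxdotC N M); ring. Qed.

(** Cauchy-Schwarz: the square of [mxdot N N *: M - mxdot M N *: N] is [mxdot N N] times the gap
    between the squares of the two sides. *)
Lemma mxdot_le p q (M N : 'M[R]_(p, q)) : `|mxdot M N| <= fnorm M * fnorm N.
Proof.
rewrite -(@ler_pXn2r _ 2) ?nnegrE ?mulr_ge0 ?fnorm_ge0 //.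
rewrite real_normK ?num_real // exprMn !sqr_fnorm.
have := mxdot_ge0 N; rewrite le_eqVlt => /orP[/eqP/esym N0|N0].
  have -> := mxdot0_eq0 N0.
  by rewrite /mxdot mulmx0 mxtrace0 expr0n /= mulr_ge0 // mxdot_ge0.
have := mxdot_ge0 (mxdot N N *: M - mxdot M N *: N).
rewrite -!scaleNr !(mxdotDl, mxdotDr, mxdotZl, mxdotZr) (mxdotC N M).
set a := mxdot M M; set b := mxdot N N in N0 *; set c := mxdot M N => h.
rewrite -subr_ge0 -(pmulr_rge0 _ N0); apply: le_trans h _.
by rewrite le_eqVlt; apply/orP; left; apply/eqP; ring.
Qed.

Lemma fnormD p q (M N : 'M[R]_(p, q)) : fnorm (M + N) <= fnorm M + fnorm N.
Proof.
rewrite -(@ler_pXn2r _ 2) ?nnegrE ?addr_ge0 ?fnorm_ge0 // sqr_fnormD sqrrD.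
have := le_trans (ler_norm _) (mxdot_le M N).
by move=> h; rewrite lerD2r lerD2l mulr_natl ler_pMn2r.
Qed.

Lemma fnormB p q (M N : 'M[R]_(p, q)) : fnorm (M - N) <= fnorm M + fnorm N.
Proof. by rewrite -(fnormN N) fnormD. Qed.

Lemma fnorm_sum p q (I : Type) (r : seq I) (Q : pred I) (F : I -> 'M[R]_(p, q)) :
  fnorm (\sum_(i <- r | Q i) F i) <= \sum_(i <- r | Q i) fnorm (F i).
Proof.
elim/big_ind2: _ => [|x1 x2 y1 y2 h1 h2|//]; first by rewrite fnorm0.
exact: le_trans (fnormD _ _) (lerD h1 h2).
Qed.

Lemma fnorm_delta p q i j : fnorm (delta_mx i j : 'M[R]_(p, q)) = 1.
Proof.
rewrite /fnorm mxdotE (bigD1 i) //= [X in X + _](bigD1 j) //= !mxE !eqxx mulr1.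
rewrite !big1 ?addr0 ?sqrtr1 // => [i' ii'|j' jj'].
  by apply: big1 => j' _; rewrite !mxE (negbTE ii') mul0r.
by rewrite !mxE (negbTE jj') andbF mul0r.
Qed.

Lemma fnorm_le_entries p q (M : 'M[R]_(p, q)) e :
  (forall i j, `|M i j| <= e) -> fnorm M <= (p * q)%:R * e.
Proof.
move=> Me; rewrite {1}(matrix_sum_delta M).
apply: le_trans (fnorm_sum _ _ _) _.
have sumc r (c : R) : r%:R * c = \sum_(i < r) c.
  by rewrite sumr_const card_ord mulr_natl.
rewrite natrM -mulrA sumc; apply: ler_sum => i _.
apply: le_trans (fnorm_sum _ _ _) _; rewrite sumc; apply: ler_sum => j _.
by rewrite fnormZ fnorm_delta mulr1.
Qed.

Lemma mxdot_mul p q r (A : 'M[R]_(p, r)) (M : 'M[R]_(r, q)) (N : 'M[R]_(p, q)) :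
  mxdot (A *m M) N = mxdot M (A^T *m N).
Proof. by rewrite /mxdot trmx_mul mulmxA. Qed.

Lemma fnorm_tr p q (M : 'M[R]_(p, q)) : fnorm M^T = fnorm M.
Proof. by rewrite /fnorm /mxdot trmxK mxtrace_mulC. Qed.

Lemma sqr_fnorm_tr p q (M : 'M[R]_(p, q)) : fnorm M ^+ 2 = \tr (M *m M^T).
Proof. by rewrite -fnorm_tr sqr_fnorm /mxdot trmxK. Qed.

(** With G = X^T X, the Gram matrix of X G - X is (G - 1) G (G - 1), which vanishes for idempotent
    G. Hence X X^T is the orthogonal projection onto the column span of X. *)
Lemma gram_fix d k (X : 'M[R]_(d, k)) :
  X^T *m X *m (X^T *m X) = X^T *m X -> X *m X^T *m X = X.
Proof.
move=> GG; apply/eqP; rewrite -subr_eq0; apply/eqP/mxdot0_eq0.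
rewrite /mxdot; suff -> : (X *m X^T *m X - X)^T *m (X *m X^T *m X - X) = 0.
  by rewrite mxtrace0.
have -> : (X *m X^T *m X - X)^T = X^T *m X *m X^T - X^T.
  by rewrite [(_ - _)^T]raddfB /= !trmx_mul trmxK mulmxA.
have -> : X *m X^T *m X - X = X *m (X^T *m X - 1%:M).
  by rewrite mulmxBr mulmx1 mulmxA.
by rewrite mulmxA mulmxBl -(mulmxA _ X^T) GG subrr mul0mx.
Qed.

(* Gram-Schmidt with zero columns kept: the new columns are orthogonal, each
   of norm 0 or 1, and span the same space as those of [V]. *)
Lemma gram_schmidt d k (V : 'M[R]_(d, k)) :
  exists C : 'M[R]_k, let X := V *m C in
    X *m X^T *m V = V /\ X^T *m X *m (X^T *m X) = X^T *m X.
Proof.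
elim: k V => [|k IHk] V.
  by exists 0; split; [rewrite [RHS]thinmx0 [LHS]thinmx0|rewrite [RHS]flatmx0 [LHS]flatmx0].
rewrite -[k.+1]/(1 + k)%N in V *.
rewrite -(hsubmxK V); set v := lsubmx V; set V' := rsubmx V.
have [C' /= [PV GG]] := IHk V'.
move: PV GG; move EX : (V' *m C') => X' PV GG.
have PX := gram_fix GG.
pose w := v - X' *m X'^T *m v.
have Xw : X'^T *m w = 0.
  have PXt : X'^T *m X' *m X'^T = X'^T.
    by have := congr1 trmx PX; rewrite !trmx_mul trmxK mulmxA.
  by rewrite mulmxBr !mulmxA PXt subrr.
have Ew : w = v - X' *m X'^T *m v by [].
(* As 0^-1 = 0, a vector already in the span of X' contributes a zero column. *)
clearbody w; pose s := (fnorm w)^-1.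
have Ev : w + X' *m X'^T *m v = v by rewrite Ew subrK.
have ww : w^T *m w = (fnorm w ^+ 2)%:M.
  by rewrite sqr_fnorm /mxdot trace_mx11 -mx11_scalar.
have sw : s ^+ 2 *: (w *m (w^T *m w)) = w.
  have [w0|w0] := eqVneq (fnorm w) 0.
    by rewrite (fnorm0_eq0 w0) mul0mx scaler0.
  by rewrite ww mul_mx_scalar scalerA -exprMn mulVf // expr1n scale1r.
exists (block_mx s%:M 0 (- s *: (C' *m X'^T *m v)) C') => /=.
set X := _ *m block_mx _ _ _ _.
have {X}-> : X = row_mx (s *: w) X'.
  rewrite /X mul_row_block mulmx0 add0r mul_mx_scalar -scalemxAr scaleNr.
  by rewrite !mulmxA EX -scalerBr -Ew.
have wX : w^T *m X' = 0 by rewrite -[X']trmxK -trmx_mul Xw trmx0.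
rewrite tr_row_mx; split.
  have E : row_mx (s *: w) X' *m col_mx (s *: w)^T X'^T = s ^+ 2 *: (w *m w^T) + X' *m X'^T.
    by rewrite mul_row_col linearZ /= -scalemxAl -scalemxAr scalerA expr2.
  rewrite E mul_mx_row; congr row_mx; rewrite mulmxDl.
    rewrite -scalemxAl -mulmxA -{1}Ev mulmxDr !mulmxA wX !mul0mx addr0.
    by rewrite sw Ev.
  have wV : w *m w^T *m V' = 0 by rewrite -PV !mulmxA -(mulmxA w) wX mulmx0 !mul0mx.
  by rewrite -scalemxAl wV scaler0 add0r.
have -> : (s *: w)^T = s *: w^T by rewrite linearZ.
have e2 : w^T *m w *m (s ^+ 2 *: (w^T *m w)) = w^T *m w.
  by rewrite -scalemxAr -mulmxA scalemxAr sw.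
rewrite mul_col_row -!scalemxAl -!scalemxAr Xw wX !scaler0.
rewrite mulmx_block !mul0mx !mulmx0 !addr0 !add0r GG; congr block_mx.
by rewrite scalerA -expr2 -scalemxAl e2.
Qed.

(** A diagonal entry of a symmetric idempotent G is the sum of the squares of its column, so G_ii >=
    G_ii^2 and G_ii <= 1. *)
Lemma trace_proj_le d k (X : 'M[R]_(d, k)) :
  X^T *m X *m (X^T *m X) = X^T *m X -> \tr (X *m X^T) <= k%:R.
Proof.
rewrite mxtrace_mulC; set G := X^T *m X => GG.
rewrite -[k in k%:R]card_ord /mxtrace -sumr_const; apply: ler_sum => i _.
have /matrixP/(_ i i) : G^T *m G = G by rewrite {1}/G trmx_mul trmxK.
rewrite mxE (bigD1 i) //= mxE => Gi.
have : G i i * G i i <= G i i.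
  rewrite -[leRHS]Gi lerDl sumr_ge0 // => j _; rewrite mxE -expr2; exact: sqr_ge0.
by have [//|] := leP (G i i) 1; nra.
Qed.

(** Pythagoras for the projection G = X^T X: |Y|^2 = |Y - G Y|^2 + |X Y|^2. *)
Lemma fnorm_proj_le d k r (X : 'M[R]_(d, k)) (Y : 'M[R]_(k, r)) :
  X^T *m X *m (X^T *m X) = X^T *m X -> fnorm (X *m Y) <= fnorm Y.
Proof.
have GT : (X^T *m X)^T = X^T *m X by rewrite trmx_mul trmxK.
have XX : mxdot Y (X^T *m X *m Y) = fnorm (X *m Y) ^+ 2.
  by rewrite sqr_fnorm mxdot_mul mulmxA.
move: GT XX; move: (X^T *m X) => G GT XX GG.
rewrite -(@ler_pXn2r _ 2) ?nnegrE ?fnorm_ge0 //.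
have := mxdot_ge0 (Y - G *m Y); rewrite -sqr_fnorm sqr_fnormD fnormN.
have -> : mxdot Y (- (G *m Y)) = - fnorm (X *m Y) ^+ 2.
  by rewrite -scaleN1r mxdotZr mulN1r XX.
have -> : fnorm (G *m Y) ^+ 2 = fnorm (X *m Y) ^+ 2.
  by rewrite sqr_fnorm mxdot_mul GT mulmxA GG.
nra.
Qed.

End Frobenius.

Section PSD.
Context {R : realType}.

(** Cholesky factorisation by induction on the size: for a corner a > 0 the Schur complement Z' - b
    b^T / a is again psd. If a = 0, positivity forces b = 0, and [s] is 0 because 0^-1 = 0. *)
Lemma psd_factor d (Z : 'M[R]_d) : psd_cone d Z ->
  exists W : 'M[R]_d, Z = W *m W^T.
Proof.
elim: d Z => [|d IHd] Z; first by exists 0; rewrite [Z]flatmx0 [RHS]flatmx0.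
rewrite -[d.+1]/(1 + d)%N in Z *; move=> [Zsym Zpos].
pose a := Z (lshift d 0) (lshift d 0); pose b := dlsubmx Z; pose Z' := drsubmx Z.
have EZ : Z = block_mx a%:M b^T b Z'.
  rewrite -{1}(submxK Z); congr block_mx; last by rewrite /b trmx_dlsub Zsym.
  rewrite [LHS]mx11_scalar; congr (_%:M); rewrite 2!mxE; congr (Z (lshift d _) (lshift d _)); exact: val_inj.
have Z'sym : Z'^T = Z' by rewrite /Z' trmx_drsub Zsym.
have form (t : R) (v : 'cV_d) : 0 <= a * t ^+ 2 + 2 * t * mxdot b v + (v^T *m Z' *m v) 0 0.
  have bv : mxdot b v = (v^T *m b) 0 0 by rewrite mxdotC /mxdot trace_mx11.
  have bv' : (b^T *m v) 0 0 = (v^T *m b) 0 0 by rewrite -bv /mxdot trace_mx11.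
  have := Zpos (col_mx t%:M v); rewrite EZ tr_col_mx mul_row_block mul_row_col.
  rewrite tr_scalar_mx -scalar_mxM mul_mx_scalar mul_scalar_mx mulmxDl -scalemxAl.
  suff -> : (t *: ((t * a)%:M + v^T *m b) + (t *: (b^T *m v) + v^T *m Z' *m v)) 0 0 =
     a * t ^+ 2 + 2 * t * mxdot b v + (v^T *m Z' *m v) 0 0 by [].
  have E (A B C D : 'M[R]_1) : (t *: (A + B) + (t *: C + D)) 0 0 =
      t * (A 0 0 + B 0 0) + (t * C 0 0 + D 0 0) by rewrite !mxE.
  by rewrite E bv' -bv mxE eqxx mulr1n; ring.
have a0 : 0 <= a.
  have := form 1 0; rewrite mulmx0 mxE.
  by rewrite /mxdot mulmx0 mxtrace0; lra.
pose s := (Num.sqrt a)^-1.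
have sa : (s * Num.sqrt a) *: b = b.
  have [a00|an0] := eqVneq a 0; last first.
    by rewrite mulVf ?scale1r // sqrtr_eq0 -ltNge lt_neqAle eq_sym an0.
  suff -> : b = 0 by rewrite scaler0.
  apply: mxdot0_eq0; set c := mxdot b b.
  apply/eqP; apply: contraT => c0.
  (* With a = 0 and b nonzero, this choice of t would give the form the value -1. *)
  have := form (- ((b^T *m Z' *m b) 0 0 + 1) / (2 * c)) b.
  rewrite a00 mul0r add0r -/c.
  have -> : 2 * (- ((b^T *m Z' *m b) 0 0 + 1) / (2 * c)) * c = - ((b^T *m Z' *m b) 0 0 + 1).
    by field.
  lra.
have [|W' EW] := IHd (Z' - s ^+ 2 *: (b *m b^T)).
  split=> [|v]; first by rewrite linearB linearZ /= trmx_mul trmxK Z'sym.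
  (* For a > 0 this t = - mxdot b v / a minimises the form, and the minimum is the Schur complement
     evaluated at v. *)
  have := form (- s ^+ 2 * mxdot b v) v.
  have -> : (v^T *m (Z' - s ^+ 2 *: (b *m b^T)) *m v) 0 0 =
            (v^T *m Z' *m v) 0 0 - s ^+ 2 * mxdot b v ^+ 2.
    rewrite mulmxBr mulmxBl -scalemxAr -scalemxAl mxE; congr (_ + _).
    rewrite 2!mxE; congr (- (_ * _)).
    have -> : v^T *m (b *m b^T) *m v = (v^T *m b) *m (b^T *m v) by rewrite !mulmxA.
    rewrite [v^T *m b]mx11_scalar [b^T *m v]mx11_scalar.
    rewrite -scalar_mxM mxE mulr1n -trace_mx11 -[(b^T *m v) 0 0]trace_mx11.
    by rewrite -/(mxdot b v) -/(mxdot v b) mxdotC.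
  move/le_trans; apply; rewrite le_eqVlt; apply/orP; left; apply/eqP.
  have -> : a * (- s ^+ 2 * mxdot b v) ^+ 2 = s ^+ 2 * mxdot b v ^+ 2.
    have [a00|an0] := eqVneq a 0; first by rewrite /s a00 sqrtr0 invr0; ring.
    by rewrite /s -{1}(sqr_sqrtr a0); field; rewrite sqrtr_eq0 -ltNge lt_neqAle eq_sym an0.
  ring.
exists (block_mx (Num.sqrt a)%:M 0 (s *: b) W').
rewrite tr_block_mx tr_scalar_mx trmx0 mulmx_block !mulmx0 !mul0mx !addr0 -EW.
rewrite -scalar_mxM -expr2 sqr_sqrtr // mul_scalar_mx linearZ /= !mul_mx_scalar !scalerA.
rewrite -scalemxAl -scalemxAr scalerA -expr2.
rewrite [_ + (_ - _)]addrC subrK (mulrC (Num.sqrt a)) sa.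
have -> : (s * Num.sqrt a) *: b^T = b^T by rewrite -[in RHS]sa linearZ.
by rewrite EZ.
Qed.

End PSD.

(** * Independence and expectations *)

Section Transfer.
Context {R : realType}.
Local Open Scope ereal_scope.
Import HBNNSimple.

Lemma integral_nnsfun_weight d (T : measurableType d)
    (m : {measure set T -> \bar R}) (Y : T -> R) (W : T -> \bar R)
    (psi : {nnsfun R >-> R}) :
  measurable_fun [set: T] Y -> measurable_fun [set: T] W -> (forall x, 0 <= W x) ->
  \int[m]_x ((psi (Y x))%:E * W x) =
  \sum_(v \in range psi) v%:E * \int[m]_(x in Y @^-1` (psi @^-1` [set v])) W x.
Proof.
move=> mY mW W0.
have mA v : measurable (Y @^-1` (psi @^-1` [set v])).
  by rewrite -[X in measurable X]setTI; apply: mY => //; exact: (measurable_sfunP psi).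
have E x : (psi (Y x))%:E * W x = \sum_(v \in range psi)
    (v%:E * ((\1_(Y @^-1` (psi @^-1` [set v])) x)%:E * W x)).
  rewrite {1}fimfunE -fsumEFin // ge0_mule_fsuml.
    by apply: eq_fsbigr => v _; rewrite EFinM muleA.
  by move=> v; rewrite lee_fin; exact: nnfun_muleindic_ge0.
under eq_integral do rewrite E.
have I0 v x : 0 <= (\1_(Y @^-1` (psi @^-1` [set v])) x)%:E * W x.
  by rewrite mule_ge0 ?lee_fin.
have mI v : measurable_fun [set: T]
    (fun x => (\1_(Y @^-1` (psi @^-1` [set v])) x)%:E * W x).
  by apply: emeasurable_funM => //; apply/measurable_EFinP; exact: measurable_indic.
rewrite (eq_integral (fun x => \sum_(v \in range psi)
    (`|v|%:E * ((\1_(Y @^-1` (psi @^-1` [set v])) x)%:E * W x)))); last first.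
  by move=> x _; apply: eq_fsbigr => v /set_mem [y _ <-]; rewrite ger0_norm.
rewrite ge0_integral_fsum //; first last.
- by move=> v x _; rewrite mule_ge0 // lee_fin.
- by move=> v; apply: emeasurable_funM.
apply: eq_fsbigr => v /set_mem [y _ <-].
rewrite ger0_norm // ge0_integralZl // ?lee_fin //; congr (_ * _).
rewrite [RHS]integral_mkcond epatch_indic; apply: eq_integral => x _.
by rewrite muleC.
Qed.

(** Change of variables between weighted measures, by monotone approximation of [f]. With a density
    as weight it computes Gaussian expectations; with a product of the other factors as weight it
    splits off one independent factor. *)
Lemma integral_transfer d1 d2 (T1 : measurableType d1) (T2 : measurableType d2)
    (m1 : {measure set T1 -> \bar R}) (m2 : {measure set T2 -> \bar R})
    (Y1 : T1 -> R) (W1 : T1 -> \bar R) (Y2 : T2 -> R) (W2 : T2 -> \bar R)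
    (f : R -> R) :
  measurable_fun [set: T1] Y1 -> measurable_fun [set: T1] W1 -> (forall x, 0 <= W1 x) ->
  measurable_fun [set: T2] Y2 -> measurable_fun [set: T2] W2 -> (forall x, 0 <= W2 x) ->
  (forall U, measurable U -> \int[m1]_(x in Y1 @^-1` U) W1 x = \int[m2]_(x in Y2 @^-1` U) W2 x) ->
  measurable_fun [set: R] f -> (forall y, (0 <= f y)%R) ->
  \int[m1]_x ((f (Y1 x))%:E * W1 x) = \int[m2]_x ((f (Y2 x))%:E * W2 x).
Proof.
move=> mY1 mW1 W10 mY2 mW2 W20 E /measurable_EFinP mf f0.
have f0' y : 0 <= (EFin \o f) y by rewrite lee_fin.
pose psi := nnsfun_approx measurableT mf.
have L d (T : measurableType d) (m : {measure set T -> \bar R}) (Y : T -> R) (W : T -> \bar R) :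
    measurable_fun [set: T] Y -> measurable_fun [set: T] W -> (forall x, 0 <= W x) ->
    \int[m]_x ((f (Y x))%:E * W x) = limn (fun n => \int[m]_x ((psi n (Y x))%:E * W x)).
  move=> mY mW W0.
  rewrite -monotone_convergence //; first last.
  - move=> x _ a b ab; rewrite lee_wpmul2r // lee_fin.
    by have /lefP := nd_nnsfun_approx measurableT mf ab; apply.
  - by move=> n x _; rewrite mule_ge0 ?lee_fin.
  - move=> n; apply: emeasurable_funM => //; apply/measurable_EFinP.
    by apply: (measurableT_comp (measurable_funPT (psi n))).
  apply: eq_integral => x _; apply/esym/cvg_lim => //.
  have cf := cvg_nnsfun_approx measurableT mf (fun y _ => f0' y) (x := Y x) I.
  (* The limit of a product is problematic at 0 * +oo; where [f] vanishes, all its approximants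
     vanish as well. *)
  have [fY0|fYn0] := eqVneq (f (Y x))%:E 0.
    have psi0 n : (psi n (Y x))%:E = 0.
      apply/eqP; rewrite eq_le; apply/andP; split; last by rewrite lee_fin.
      by rewrite -[leRHS]fY0 /psi nnsfun_approxE; exact: le_approx.
    rewrite fY0 mul0e (_ : (fun n => _) = cst 0); first exact: cvg_cst.
    by apply/funext => n; rewrite psi0 mul0e.
  apply: (cvgeM (g := fun=> W x)) => //; last exact: cvg_cst.
  by have [?|?] := boolP (W x \is a fin_num); [exact: mule_def_fin|exact: mule_def_neq0_infty].
rewrite !L //; congr (limn _); apply/funext => n.
rewrite (integral_nnsfun_weight m1 (psi n) mY1 mW1 W10).
rewrite (integral_nnsfun_weight m2 (psi n) mY2 mW2 W20).
by apply: eq_fsbigr => v _; rewrite E //; exact: (measurable_sfunP (psi n)).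
Qed.

End Transfer.

Section Independence.
Context {R : realType} {disp : measure_display} {T : measurableType disp}.
Variable P : probability T R.
Local Open Scope ereal_scope.

(** The induction in [key] turns probabilities into expectations one index at a time. It is uniform
    in the rectangles [A U], because varying the side U j yields exactly the equality of weighted
    measures required by [integral_transfer]. *)
Lemma independent_expectation_prod (I : finType) (F : I -> set (set T))
    (Y : I -> T -> R) :
  independent P F -> (forall i, measurable_fun [set: T] (Y i)) ->
  (forall i w, (0 <= Y i w)%R) ->
  (forall i U, measurable U -> F i (Y i @^-1` U)) ->
  \int[P]_w (\prod_i Y i w)%R%:E = \prod_i \int[P]_w (Y i w)%:E.
Proof.
move=> indF mY Y0 FY.
have mYU i (U : set R) : measurable U -> measurable (Y i @^-1` U).
  by move=> mU; rewrite -[X in measurable X]setTI; exact: mY.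
pose A (U : I -> set R) := \bigcap_(i in [set: I]) (Y i @^-1` U i).
have mA U : (forall i, measurable (U i)) -> measurable (A U).
  by move=> mU; apply: fin_bigcap_measurable => // i _; exact: mYU.
have key s : uniq s -> forall U, (forall i, measurable (U i)) ->
    \int[P]_(w in A U) (\prod_(i <- s) Y i w)%R%:E =
    \prod_i (if i \in s then \int[P]_(w in Y i @^-1` U i) (Y i w)%:E
             else P (Y i @^-1` U i)).
  elim: s => [_|j s IHs /andP[js us]] U mU.
    under eq_integral do rewrite big_nil.
    rewrite integral_cst ?mul1e; last exact: mA.
    transitivity (P (\bigcap_(i in [set` [set: I]%SET]) (Y i @^-1` U i))).
      by congr (P _); apply: eq_bigcapl; split=> i //= _; rewrite inE.
    rewrite indF; first by apply: eq_bigl => i; rewrite inE.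
    by move=> i _; exact: FY.
  pose W w := ((\prod_(i <- s) Y i w) * \1_(A U) w)%R%:E.
  have W0 w : 0 <= W w.
    by rewrite lee_fin mulr_ge0 // prodr_ge0.
  have mW : measurable_fun [set: T] W.
    apply/measurable_EFinP; apply: measurable_funM; first exact: measurable_prod.
    exact/measurable_indic/mA.
  pose c := \prod_(i | i != j) (if i \in s then \int[P]_(w in Y i @^-1` U i) (Y i w)%:E
             else P (Y i @^-1` U i)).
  have c0 : 0 <= c.
    by apply: prode_ge0 => i _; case: ifP => _ //; apply: integral_ge0 => w _; rewrite lee_fin.
  pose W2 w := c * (\1_(Y j @^-1` U j) w)%:E.
  have W20 w : 0 <= W2 w by rewrite mule_ge0 ?lee_fin.
  have mW2 : measurable_fun [set: T] W2.
    apply: measurable_funeM; apply/measurable_EFinP; exact/measurable_indic/mYU.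
  have E V : measurable V ->
      \int[P]_(w in Y j @^-1` V) W w = \int[P]_(w in Y j @^-1` V) W2 w.
    move=> mV.
    pose U' i := if i == j then U j `&` V else U i.
    have mU' i : measurable (U' i) by rewrite /U'; case: ifP => _ //; exact: measurableI.
    have AU' : A U' = Y j @^-1` V `&` A U.
      apply/seteqP; split=> w.
        move=> h; split; first by have := h j Logic.I; rewrite /U' eqxx => -[].
        by move=> i _; have := h i Logic.I; rewrite /U'; case: eqP => [->[]|].
      by move=> [h1 h2] i _ /=; rewrite /U'; case: eqP => [->|_]; [split => //; exact: (h2 j)|exact: (h2 i)].
    transitivity (\int[P]_(w in A U') (\prod_(i <- s) Y i w)%R%:E).
      rewrite integral_mkcond [RHS]integral_mkcond; apply: eq_integral => w _.
      rewrite !epatch_indic -!EFinM AU' indicI /= mulrAC mulrA.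
      by congr (_%:E); rewrite -mulrA; congr (_ * _)%R; rewrite mulrC.
    rewrite IHs // (bigD1 j) //= (negbTE js).
    have mI : measurable_fun (Y j @^-1` V) (fun w => (\1_(Y j @^-1` U j) w)%:E : \bar R).
      by apply/measurable_funTS/measurable_EFinP/measurable_indic/mYU.
    have I0 w : (Y j @^-1` V) w -> 0 <= (\1_(Y j @^-1` U j) w)%:E :> \bar R.
      by rewrite lee_fin.
    rewrite (ge0_integralZl _ (mYU _ _ mV) mI I0 c0).
    rewrite integral_indic //; [|exact: mYU..].
    rewrite muleC /U' eqxx; congr (_ * _).
    by apply: eq_bigr => i /negbTE ->.
  (* [integral_transfer] wants a function that is nonnegative on the whole line; the positive part
     agrees with the identity on the values of Y j. *)
  transitivity (\int[P]_w ((Num.max (Y j w) 0)%:E * W w)).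
    rewrite integral_mkcond; apply: eq_integral => w _.
    rewrite max_l // /W -EFinM epatch_indic -EFinM big_cons; congr (_%:E).
    by rewrite mulrA.
  have mmax : measurable_fun [set: R] (fun y : R => Num.max y 0%R).
    exact: measurable_maxr.
  rewrite (integral_transfer (mY j) mW W0 (mY j) mW2 W20 E mmax); last first.
    by move=> y; rewrite le_max lexx orbT.
  rewrite (bigD1 j) //= mem_head.
  transitivity (\int[P]_w (c * (Y j w * \1_(Y j @^-1` U j) w)%:E)).
    apply: eq_integral => w _; rewrite max_l // EFinM /W2.
    by rewrite muleCA.
  have mI : measurable_fun [set: T] (fun w => (Y j w * \1_(Y j @^-1` U j) w)%:E : \bar R).
    by apply/measurable_EFinP/measurable_funM => //; exact/measurable_indic/mYU.
  have I0 w : [set: T] w -> 0 <= (Y j w * \1_(Y j @^-1` U j) w)%:E :> \bar R.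
    by rewrite lee_fin mulr_ge0.
  rewrite (ge0_integralZl _ measurableT mI I0 c0).
  rewrite muleC [in RHS]integral_mkcond; congr (_ * _).
    by apply: eq_integral => w _; rewrite epatch_indic EFinM.
  by apply: eq_bigr => i ij; rewrite inE (negbTE ij).
have := key (index_enum I) (index_enum_uniq I) (fun=> setT) (fun=> measurableT).
have -> : A (fun=> setT) = setT by rewrite /A; apply/seteqP; split=> // w _ i _.
move=> ->; apply: eq_bigr => i _; by rewrite mem_index_enum preimage_setT.
Qed.

End Independence.

(** * Gaussian tails *)

Section GaussianMgf.
Context {R : realType} {disp : measure_display} {T : measurableType disp}.
Variable P : probability T R.

(** Completing the square: exp (t y) times the density of N(0, s^2) is exp (t^2 s^2 / 2) times the
    density of N(t s^2, s^2). *)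
Lemma normal_mgf (X : {RV P >-> R}) (s t : R) : s != 0 ->
  (forall U : set R, measurable U -> distribution P X U = normal_prob 0 s U) ->
  (\int[P]_w (expR (t * X w))%:E = (expR (t ^+ 2 * s ^+ 2 / 2))%:E)%E.
Proof.
move=> s0 dX.
have mexp : measurable_fun [set: R] (fun y : R => expR (t * y)).
  by apply: measurableT_comp => //; exact: measurable_funM.
have pdf0 m (y : R) : (0 <= (normal_pdf m s y)%:E)%E.
  by rewrite lee_fin normal_pdf_ge0.
have mpdf m : measurable_fun [set: R] (fun y : R => (normal_pdf m s y)%:E).
  by apply/measurable_EFinP; exact: measurable_normal_pdf.
rewrite (eq_integral (fun w => (expR (t * X w))%:E * cst 1%E w)%E); last first.
  by move=> w _; rewrite mule1.
transitivity (\int[lebesgue_measure]_y ((expR (t * y))%:E * (normal_pdf 0 s y)%:E))%E.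
  apply: (@integral_transfer _ _ _ _ _ P lebesgue_measure X (cst 1%E) id
    (fun y => (normal_pdf 0 s y)%:E) (fun y => expR (t * y))) => //; [exact: mpdf|move=> U mU].
  rewrite integral_cst ?mul1e; first exact: dX.
  by rewrite -[V in measurable V]setTI; exact: measurable_funPT.
transitivity (\int[lebesgue_measure]_y ((expR (t ^+ 2 * s ^+ 2 / 2))%:E *
    (normal_pdf (t * s ^+ 2) s y)%:E))%E.
  apply: eq_integral => y _; rewrite -!EFinM !normal_pdfE // /normal_fun.
  rewrite !(mulrCA _ (normal_peak s)) -!expRD; congr (_ * expR _)%:E.
  by field.
rewrite ge0_integralZl ?integral_normal_pdf ?mule1 //.
exact: mpdf.
Qed.

End GaussianMgf.

(** * A pointwise inequality for the lower tail *)

Section Numeric.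
Context {R : realType}.

Lemma expR_le_inv (x : R) : 0 <= x -> expR (- x) <= (1 + x)^-1.
Proof.
move=> x0; rewrite expRN lef_pV2 ?posrE ?expR_gt0 ?expR_ge1Dx //.
by rewrite ltr_pwDl.
Qed.

Lemma ln32_le : ln (3 / 2) <= 1 / 2 :> R.
Proof.
rewrite -[leRHS]expRK ler_ln ?posrE ?expR_gt0 //.
by apply: le_trans (expR_ge1Dx _); lra.
Qed.

(* With [c = cosh (tau x)] and [u = c - 1], the bound reads
   [exp (- 4 x^2) <= 1 - u / 2 + u^2 / 8]. *)
Lemma expR_sqr_le_cosh (tau x : R) : tau ^+ 2 = 2 * ln (3 / 2) ->
  expR (- (4 * x ^+ 2)) + 3 / 8 * (expR (tau * x) + expR (- tau * x)) <=
  27 / 16 + 1 / 32 * (expR (2 * tau * x) + expR (- (2 * tau) * x)).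
Proof.
move=> tau2; have ln32 := ln32_le.
have -> : 2 * tau * x = tau * x + tau * x by ring.
have -> : - (2 * tau) * x = - tau * x + - tau * x by ring.
rewrite !expRD mulNr; set y := tau * x; set e := expR y; set e' := expR (- y).
have ee : e * e' = 1 by rewrite -expRD subrr expR0.
have e0 : 0 < e := expR_gt0 _.
have e'0 : 0 < e' := expR_gt0 _.
have q0 := sqr_ge0 x.
have E1 : expR (- (4 * x ^+ 2)) <= (1 + 4 * x ^+ 2)^-1 by apply: expR_le_inv; lra.
(* For x^2 > 1/4 the left side is below 1/2, the minimum of 1 - u / 2 + u^2 / 8, attained at u = 2,
   that is at cosh = 3. *)
have [xs|xs] := leP (x ^+ 2) (1 / 4); last first.
  have : (1 + 4 * x ^+ 2)^-1 <= 1 / 2.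
    by rewrite -[leRHS]invrK lef_pV2 ?posrE; lra.
  have := sqr_ge0 (e + e' - 6).
  have -> : (e + e' - 6) ^+ 2 = e * e + e' * e' + 2 * (e * e') - 12 * (e + e') + 36 by ring.
  rewrite ee; lra.
have y2 : y ^+ 2 = 2 * ln (3 / 2) * x ^+ 2 by rewrite exprMn tau2.
have y2x : y ^+ 2 <= x ^+ 2 by rewrite y2 ler_piMl //; lra.
have yb : -1 / 2 <= y <= 1 / 2 by nra.
have h1 : e' >= 1 - y by apply: le_trans (expR_ge1Dx _).
have h2 : e >= 1 + y by exact: expR_ge1Dx.
have h3 : e * (1 - y) <= 1 by rewrite -[leRHS]ee ler_pM2l.
have h4 : e' * (1 + y) <= 1 by rewrite -[leRHS]ee mulrC ler_pM2r.
pose u := (e + e') / 2 - 1.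
(* The bounds e <= 1 / (1 - y) and e' <= 1 / (1 + y) give cosh y <= 1 / (1 - y^2), with y^2 <= x^2
   <= 1/4. *)
have u1 : u <= 4 / 3 * x ^+ 2.
  suff : (e + e') * (1 - y ^+ 2) <= 2.
    have : 1 - y ^+ 2 > 0 by lra.
    rewrite /u; nra.
  nra.
have -> : e * e + e' * e' = (e + e') ^+ 2 - 2 * (e * e') by ring.
rewrite ee mulr1.
have E2 : (1 + 4 * x ^+ 2)^-1 <= 1 - u / 2.
  rewrite invf_ple ?posrE; [|lra|lra].
  have h5 : 1 - 2 / 3 * x ^+ 2 <= 1 - u / 2 by lra.
  have h6 : (1 - 2 / 3 * x ^+ 2) * (1 + 4 * x ^+ 2) >= 1 by nra.
  have h7 : 0 < 1 - u / 2 by lra.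
  rewrite invf_ple ?posrE; [|lra|lra].
  have h8 : 0 < 1 + 4 * x ^+ 2 by lra.
  rewrite -[(1 + _)^-1]mul1r ler_pdivrMr //; nra.
have : expR (- (4 * x ^+ 2)) <= 1 - u / 2 + u ^+ 2 / 8.
  by apply: le_trans E1 (le_trans E2 _); rewrite lerDl divr_ge0 ?sqr_ge0.
rewrite /u; nra.
Qed.

End Numeric.

Section Sampling.
Context {R : realType}.

Definition trace_row n d (A : 'I_n -> 'M[R]_d) (N : 'M[R]_d) : 'rV[R]_n :=
  \row_i \tr (A i *m N).

End Sampling.

Section MatrixTails.
Context {R : realType} {disp : measure_display} {T : measurableType disp}.
Variable P : probability T R.

Lemma trace_sampleE d (A : random_matrix P d) (N : 'M[R]_d) w :
  \tr (sample A w *m N) = \sum_(ab : 'I_d * 'I_d) N ab.2 ab.1 * A ab.1 ab.2 w.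
Proof.
rewrite -(pair_bigA _ (fun a b => N b a * A a b w)) /=.
by apply: eq_bigr => a _; rewrite mxE; apply: eq_bigr => b _; rewrite mxE mulrC.
Qed.

Lemma measurable_trace_sample d (A : random_matrix P d) (N : 'M[R]_d) :
  measurable_fun [set: T] (fun w => \tr (sample A w *m N)).
Proof.
under eq_fun do rewrite trace_sampleE.
by apply: measurable_sum => ab; exact: measurable_funM.
Qed.

(** Independence is assumed for the sigma-algebras generated by the entries, so events about tr (A
    N) have to be located there. *)
Lemma sigma_matrix_trace d (A : random_matrix P d) (N : 'M[R]_d) (U : set R) :
  measurable U -> sigma_matrix A ((fun w => \tr (sample A w *m N)) @^-1` U).
Proof.
move=> mU; rewrite /sigma_matrix; set G := \bigcup_(ab in _) _.
have mA a b : measurable_fun [set: g_sigma_algebraType G] (A a b : _ -> R).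
  move=> _ V mV; rewrite setTI; apply: sub_sigma_algebra.
  by exists (a, b) => //=; exists V => //; rewrite setTI.
have : measurable_fun [set: g_sigma_algebraType G] (fun w => \tr (sample A w *m N)).
  under eq_fun do rewrite trace_sampleE.
  by apply: measurable_sum => ab; exact: measurable_funM.
by move=> /(_ measurableT U mU); rewrite setTI.
Qed.

Lemma gaussian_trace_mgf d (A : random_matrix P d) (s2 t : R) (N : 'M[R]_d) :
  0 < s2 -> gaussian_matrix s2 A ->
  (\int[P]_w (expR (t * \tr (sample A w *m N)))%:E =
   (expR (t ^+ 2 * mxdot N N * s2 / 2))%:E)%E.
Proof.
move=> s0 [indA dA].
have sq0 : Num.sqrt s2 != 0 by rewrite gt_eqF // sqrtr_gt0.
pose Y (ab : 'I_d * 'I_d) w := expR (t * N ab.2 ab.1 * A ab.1 ab.2 w).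
have mphi c : measurable_fun [set: R] (fun x : R => expR (c * x)).
  by apply: measurableT_comp => //; exact: measurable_funM.
transitivity (\int[P]_w (\prod_ab Y ab w)%R%:E)%E.
  apply: eq_integral => w _; rewrite trace_sampleE -expR_sum mulr_sumr.
  by congr (expR _)%:E; apply: eq_bigr => ab _; rewrite mulrA.
rewrite (independent_expectation_prod indA); first last.
- move=> ab U mU; exists ((fun x => expR (t * N ab.2 ab.1 * x)) @^-1` U) => //.
    by rewrite -[V in measurable V]setTI; exact: mphi.
  by rewrite setTI.
- by move=> ab w; exact: expR_ge0.
- move=> ab; exact: (measurableT_comp (mphi _) (measurable_funPT (A ab.1 ab.2))).
under eq_bigr => ab _ do rewrite (normal_mgf _ sq0 (dA _ _)).
rewrite prodEFin -expR_sum; congr (expR _)%:E.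
rewrite sqr_sqrtr ?ltW // -!mulr_suml mxdotE exchange_big /= pair_bigA /= mulr_sumr.
by congr (_ * _ / _); apply: eq_bigr => ab _; rewrite exprMn expr2.
Qed.

Lemma markov_event (B : set T) (f : T -> R) (c : R) : measurable B ->
  measurable_fun [set: T] f -> (forall w, 0 <= f w) -> (forall w, B w -> 1 <= f w) ->
  (\int[P]_w (f w)%:E <= c%:E)%E -> (P B <= c%:E)%E.
Proof.
move=> mB mf f0 fB; apply: le_trans.
rewrite -[B in P B]setIT -integral_indic //.
apply: ge0_le_integral => //; first exact/measurable_EFinP/measurable_indic.
  exact/measurable_EFinP.
move=> w _; rewrite lee_fin indicE; case: (boolP (w \in B)) => // /set_mem; exact: fB.
Qed.

Section Independent.
Variables (n d : nat) (A : 'I_n -> random_matrix P d).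
Hypothesis n0 : (0 < n)%N.
Hypothesis indA : independent P (fun i => sigma_matrix (A i)).
Hypothesis gaussA : forall i, gaussian_matrix (1 / n%:R) (A i).

Lemma independent_trace_prod (N : 'M[R]_d) (phi : 'I_n -> R -> R) :
  (forall i, measurable_fun [set: R] (phi i)) -> (forall i x, 0 <= phi i x) ->
  (\int[P]_w (\prod_i phi i (\tr (sample (A i) w *m N)))%:E =
   \prod_i \int[P]_w (phi i (\tr (sample (A i) w *m N)))%:E)%E.
Proof.
move=> mphi phi0.
apply: (independent_expectation_prod indA (Y := fun i w => phi i (\tr (sample (A i) w *m N)))).
- move=> i; exact: (measurableT_comp (mphi i) (measurable_trace_sample _ _)).
- by [].
- move=> i U mU; have := @sigma_matrix_trace _ (A i) N (phi i @^-1` U); apply.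
  by rewrite -[V in measurable V]setTI; exact: mphi.
Qed.

Lemma gaussian_row_mgf (z : 'rV[R]_n) (N : 'M[R]_d) (t : R) :
  (\int[P]_w (expR (t * mxdot z (trace_row (fun i => sample (A i) w) N)))%:E =
   (expR (t ^+ 2 * mxdot z z * mxdot N N / (2 * n%:R)))%:E)%E.
Proof.
have nR : 0 < n%:R :> R by rewrite ltr0n.
transitivity (\int[P]_w (\prod_i expR (t * z 0 i * \tr (sample (A i) w *m N)))%:E)%E.
  apply: eq_integral => w _; rewrite -expR_sum mxdotE big_ord1 mulr_sumr.
  by congr (expR _)%:E; apply: eq_bigr => i _; rewrite mxE mulrA.
rewrite (independent_trace_prod N (phi := fun i x => expR (t * z 0 i * x))); first last.
- by move=> i x; exact: expR_ge0.
- by move=> i; apply: measurableT_comp => //; exact: measurable_funM.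
under eq_bigr => i _ do rewrite (gaussian_trace_mgf _ _ _ (gaussA i)) ?divr_gt0 //.
rewrite prodEFin -expR_sum; congr (expR _)%:E.
rewrite -!mulr_suml (mxdotE z) big_ord1 mulr_sumr.
rewrite (eq_bigr (fun i => t ^+ 2 * (z 0 i * z 0 i))); last first.
  by move=> i _; rewrite exprMn !expr2.
by field; rewrite gt_eqF.
Qed.

Lemma measurable_mxdot_row (z : 'rV[R]_n) (N : 'M[R]_d) :
  measurable_fun [set: T] (fun w => mxdot z (trace_row (fun i => sample (A i) w) N)).
Proof.
under eq_fun do rewrite mxdotE big_ord1.
apply: measurable_sum => i; under eq_fun do rewrite mxE.
by apply: measurable_funM => //; exact: measurable_trace_sample.
Qed.

Lemma measurable_sqr_row (N : 'M[R]_d) :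
  measurable_fun [set: T] (fun w => fnorm (trace_row (fun i => sample (A i) w) N) ^+ 2).
Proof.
under eq_fun do rewrite sqr_fnorm mxdotE big_ord1.
apply: measurable_sum => i; under eq_fun do rewrite mxE.
by apply: measurable_funM; exact: measurable_trace_sample.
Qed.

Lemma measurable_row_upper (z : 'rV[R]_n) (N : 'M[R]_d) (u : R) :
  measurable [set w | u <= mxdot z (trace_row (fun i => sample (A i) w) N)].
Proof.
rewrite -[V in measurable V]setTI.
apply: (measurable_fun_ler (f := cst u) _ (measurable_mxdot_row z N)) => //.
Qed.

Lemma measurable_row_lower (N : 'M[R]_d) (u : R) :
  measurable [set w | fnorm (trace_row (fun i => sample (A i) w) N) ^+ 2 <= u].
Proof.
rewrite -[V in measurable V]setTI.
exact: (measurable_fun_ler (measurable_sqr_row N) (measurable_cst u)).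
Qed.

Lemma row_upper_tail (z : 'rV[R]_n) (N : 'M[R]_d) (u K : R) : 0 < u -> 0 < K ->
  mxdot z z * mxdot N N <= K ->
  (P [set w | (u <= mxdot z (trace_row (fun i => sample (A i) w) N))%R] <=
   (expR (- (u ^+ 2 / (2 * K)) * n%:R))%:E)%E.
Proof.
move=> u0 K0 zN; have nR : 0 < n%:R :> R by rewrite ltr0n.
(* The minimiser of the Chernoff exponent - t u + t^2 K / (2 n). *)
pose t := n%:R * u / K.
have t0 : 0 < t by rewrite /t divr_gt0 ?mulr_gt0.
pose g w := mxdot z (trace_row (fun i => sample (A i) w) N).
have mg : measurable_fun [set: T] g := measurable_mxdot_row z N.
apply: (markov_event (f := fun w => expR (- (t * u)) * expR (t * g w))).
- exact: measurable_row_upper.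
- by apply: measurable_funM => //; apply: measurableT_comp => //; exact: measurable_funM.
- by move=> w; rewrite mulr_ge0 ?expR_ge0.
- move=> w /= ug; rewrite -expRD -[leLHS]expR0 ler_expR.
  by rewrite addrC -mulrBr mulr_ge0 ?subr_ge0 // ltW.
under eq_integral do rewrite EFinM.
rewrite ge0_integralZl_EFin ?expR_ge0 //; last first.
- by apply/measurable_EFinP; apply: measurableT_comp => //; exact: measurable_funM.
rewrite gaussian_row_mgf -EFinM lee_fin -expRD ler_expR.
have h : t ^+ 2 * mxdot z z * mxdot N N / (2 * n%:R) <= t ^+ 2 * K / (2 * n%:R).
  rewrite ler_pM2r ?invr_gt0 ?mulr_gt0 // -mulrA ler_wpM2l ?sqr_ge0 //.
apply: le_trans (lerD (lexx _) h) _.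
rewrite le_eqVlt; apply/orP; left; apply/eqP; rewrite /t; field.
by rewrite !gt_eqF.
Qed.

(** A Chernoff bound for the sum of squares. The Laplace transform of a squared Gaussian is
    dominated, through [expR_sqr_le_cosh], by exponentials of linear forms, so the moment generating
    function already computed suffices. *)
Lemma row_lower_tail (N : 'M[R]_d) : N != 0 ->
  (P [set w | (fnorm (trace_row (fun i => sample (A i) w) N) ^+ 2 <=
               1 / 128 * fnorm N ^+ 2)%R] <=
   (expR (- (1 / 32) * n%:R))%:E)%E.
Proof.
move=> N0; have nR : 0 < n%:R :> R by rewrite ltr0n.
have v0 : 0 < mxdot N N.
  rewrite lt_neqAle mxdot_ge0 andbT eq_sym; apply: contra_neq N0.
  exact: mxdot0_eq0.
rewrite sqr_fnorm; set v := mxdot N N in v0 *.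
(* Each trace has variance v / n, so the exponent is -4 g^2 for a standard Gaussian g. *)
pose phi (x : R) := expR (- (4 * n%:R / v * x ^+ 2)).
have mphi : measurable_fun [set: R] phi.
  apply: measurableT_comp => //; apply: measurableT_comp => //.
  by apply: measurable_funM => //; exact: measurable_funX.
pose h i w := \tr (sample (A i) w *m N).
have mh i : measurable_fun [set: T] (h i) by exact: measurable_trace_sample.
have Ephi i : (\int[P]_w (phi (h i w))%:E <= (225 / 256)%:E)%E.
  (* A standard Gaussian [g] then has [E (cosh (tau g)) = 3 / 2]. *)
  pose tau := Num.sqrt (2 * ln (3 / 2)) : R.
  have ln0 : 0 <= 2 * ln (3 / 2) :> R by rewrite mulr_ge0 // ln_ge0; lra.
  have tau2 : tau ^+ 2 = 2 * ln (3 / 2) by rewrite sqr_sqrtr.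
  have expln : expR (ln (3 / 2)) = 3 / 2 :> R by rewrite lnK // posrE; lra.
  pose r := Num.sqrt (n%:R / v).
  have r2 : r ^+ 2 = n%:R / v by rewrite sqr_sqrtr // divr_ge0 // ltW.
  pose e (s : R) w := expR (s * r * h i w).
  have Ee s : (\int[P]_w (e s w)%:E = (expR (s ^+ 2 / 2))%:E)%E.
    rewrite /e (gaussian_trace_mgf _ _ _ (gaussA i)) ?divr_gt0 //.
    congr (expR _)%:E; rewrite exprMn r2 -/v; field.
    by rewrite !gt_eqF.
  have me s : measurable_fun [set: T] (fun w => (e s w)%:E).
    by apply/measurable_EFinP/measurableT_comp => //; exact: measurable_funM.
  have e0 s w : (0 <= (e s w)%:E)%E by rewrite lee_fin expR_ge0.
  have mphih : measurable_fun [set: T] (fun w => (phi (h i w))%:E).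
    by apply/measurable_EFinP; exact: (measurableT_comp mphi (mh i)).
  have phih0 w : (0 <= (phi (h i w))%:E)%E by rewrite lee_fin expR_ge0.
  have E2 c s : 0 <= c -> (\int[P]_w (c%:E * ((e s w)%:E + (e (- s) w)%:E)) =
      (c * (2 * expR (s ^+ 2 / 2)))%:E)%E.
    move=> c0; rewrite ge0_integralZl_EFin //; first last.
    - exact: emeasurable_funD.
    - by move=> w _; rewrite adde_ge0.
    rewrite ge0_integralD // !Ee sqrrN -EFinD -EFinM; congr (_%:E); ring.
  have D0 c s w : 0 <= c -> (0 <= c%:E * ((e s w)%:E + (e (- s) w)%:E))%E.
    by move=> c0; apply: mule_ge0; [rewrite lee_fin|exact: adde_ge0].
  have mD c s : measurable_fun [set: T] (fun w => c%:E * ((e s w)%:E + (e (- s) w)%:E))%E.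
    by apply: measurable_funeM; exact: emeasurable_funD.
  have key : (\int[P]_w ((phi (h i w))%:E + (3 / 8)%:E * ((e tau w)%:E + (e (- tau) w)%:E)) <=
     \int[P]_w ((27 / 16)%:E + (1 / 32)%:E * ((e (2 * tau) w)%:E + (e (- (2 * tau)) w)%:E)))%E.
    apply: ge0_le_integral => //.
    - by move=> w _; rewrite adde_ge0 ?D0 //; lra.
    - exact: emeasurable_funD.
    - exact: emeasurable_funD.
    move=> w _; rewrite -!EFinD -?EFinM -?EFinD lee_fin.
    have := expR_sqr_le_cosh (r * h i w) tau2.
    by rewrite exprMn r2 /phi /e !mulrA.
  have D1 w : [set: T] w -> (0 <= (3 / 8)%:E * ((e tau w)%:E + (e (- tau) w)%:E))%E.
    by move=> _; apply: D0; lra.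
  have D2 w : [set: T] w ->
      (0 <= (1 / 32)%:E * ((e (2 * tau) w)%:E + (e (- (2 * tau)) w)%:E))%E.
    by move=> _; apply: D0; lra.
  have D3 w : [set: T] w -> (0 <= (27 / 16)%:E :> \bar R)%E.
    by move=> _; rewrite lee_fin; lra.
  move: key; rewrite (ge0_integralD P measurableT (fun w _ => phih0 w) mphih D1 (mD _ _)).
  rewrite (ge0_integralD P measurableT D3 _ D2 (mD _ _)) //.
  (* With E cosh (tau g) = 3/2 and E cosh (2 tau g) = (3/2)^4 = 81/16, the bound becomes 27/16 +
     81/256 - 9/8 = 225/256. *)
  rewrite !E2; [|lra|lra].
  have -> : (2 * tau) ^+ 2 / 2 = ln (3 / 2) + ln (3 / 2) + (ln (3 / 2) + ln (3 / 2)) :> R.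
    by rewrite exprMn tau2; field.
  have -> : tau ^+ 2 / 2 = ln (3 / 2) by rewrite tau2; field.
  have -> : (\int[P]_w (27 / 16)%:E = (27 / 16)%:E)%E.
    apply: etrans (integral_cst P measurableT _) _.
    exact: etrans (congr1 (mule _) (probability_setT P)) (mule1 _).
  rewrite !expRD expln -EFinD.
  have : (0 <= \int[P]_w (phi (h i w))%:E)%E by exact: integral_ge0.
  case: (\int[P]_w _)%E => [x| |] //=.
  by rewrite -EFinD !lee_fin; lra.
have mprod : measurable_fun [set: T] (fun w => \prod_i phi (h i w)).
  by apply: measurable_prod => i _; exact: (measurableT_comp mphi (mh i)).
apply: (markov_event (f := fun w => expR (1 / 32 * n%:R) * \prod_i phi (h i w))).
- exact: measurable_row_lower.
- exact: measurable_funM.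
- by move=> w; rewrite mulr_ge0 ?expR_ge0 // prodr_ge0 // => i _; exact: expR_ge0.
- move=> w /=; rewrite sqr_fnorm mxdotE big_ord1 => hs.
  rewrite -expR_sum -expRD -[leLHS]expR0 ler_expR sumrN -mulr_sumr.
  have c0 : 0 < 4 * n%:R / v by rewrite divr_gt0 // mulr_gt0.
  rewrite subr_ge0 -ler_pdivlMl //.
  move: hs; rewrite (eq_bigr (fun i => h i w ^+ 2)) => [|i _]; last by rewrite mxE.
  move=> /le_trans; apply; rewrite le_eqVlt; apply/orP; left; apply/eqP; field.
  by rewrite !gt_eqF.
under eq_integral do rewrite EFinM.
rewrite ge0_integralZl_EFin ?expR_ge0 //; first last.
- exact/measurable_EFinP.
- by move=> w _; rewrite lee_fin prodr_ge0 // => i _; exact: expR_ge0.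
rewrite (independent_trace_prod N (phi := fun=> phi)) //; last by move=> i x; exact: expR_ge0.
have [_ prod_le] : (0 <= \prod_(i < n) \int[P]_w (phi (h i w))%:E /\
    \prod_(i < n) \int[P]_w (phi (h i w))%:E <= ((225 / 256) ^+ n)%:E)%E.
  rewrite -[n in _ ^+ n]card_ord -prodr_const -prodEFin.
  apply: (big_ind2 (fun x y : \bar R => 0 <= x /\ x <= y)%E) => [|x y x' y' [x0 xy] [x'0 xy']|i _].
  - by rewrite lee_fin lexx.
  - by split; [exact: mule_ge0|exact: lee_pmul].
  - by split => //; apply: integral_ge0 => w _; rewrite lee_fin expR_ge0.
apply: le_trans (lee_wpmul2l _ prod_le) _; first by rewrite lee_fin expR_ge0.
rewrite -EFinM lee_fin !expRM_natr -exprMn lerXn2r ?nnegrE ?mulr_ge0 ?expR_ge0 //.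
(* Since (31/32)^2 > 225/256, each factor exp (1/32) * 225/256 is at most exp (- 1/32). *)
have e1 : 31 / 32 <= expR (- (1 / 32)) :> R by apply: le_trans (expR_ge1Dx _); lra.
have e2 : expR (1 / 32) * expR (- (1 / 32)) = 1 :> R by rewrite -expRD subrr expR0.
have e3 : 0 < expR (1 / 32) :> R := expR_gt0 _.
move: e1 e2 e3; move: (expR _) (expR _) => p q q1 pq p0.
have -> : q = p * (q * q) by rewrite mulrA pq mul1r.
by rewrite ler_pM2l //; nra.
Qed.

End Independent.
End MatrixTails.

(** * Nets *)

Section Net.

(** Greedy selection: an element is kept unless it is close to one that was kept before. *)
Lemma maximal_separated (S : eqType) (close : rel S) (l : seq S) :
  reflexive close -> symmetric close ->
  exists s : seq S, [/\ {subset s <= l}, uniq s,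
    {in s &, forall x y, close x y -> x = y} &
    forall x, x \in l -> exists2 y, y \in s & close x y].
Proof.
move=> cxx csym; elim: l => [|x l [s [sl us sep cov]]]; first by exists [::].
have [/hasP[y ys xy]|/hasPn far] := boolP (has (close x) s).
  exists s; split=> // [z zs|z]; first by rewrite inE sl ?orbT.
  by rewrite inE => /predU1P[->|/cov //]; exists y.
have xs : x \notin s by apply/negP => /far; rewrite cxx.
exists (x :: s); split=> /= [z||y z|z].
- by rewrite !inE => /predU1P[->|/sl ->]; rewrite ?eqxx ?orbT.
- by rewrite xs.
- rewrite !inE => /predU1P[->|ys] /predU1P[->|zs] //; last exact: sep.
    by move=> xz; have := far _ zs; rewrite xz.
  by rewrite csym => xy; have := far _ ys; rewrite xy.
rewrite inE => /predU1P[->|/cov[y ys zy]]; first by exists x; rewrite ?mem_head.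
by exists y; rewrite // inE ys orbT.
Qed.

Context {R : realType}.
(** [D c x] stands for membership in the ball of radius c of a norm. As a relation it also covers
    the operator norm, given by its upper bounds without forming a supremum. *)
Variables (p q : nat) (D : R -> 'M[R]_(p, q) -> Prop).
Hypothesis D_sub : forall c c' x y, D c x -> D c' y -> D (c + c') (x - y).
Hypothesis D_scale : forall c (t : R) x, D c x -> D (`|t| * c) (t *: x).
Hypothesis D_le : forall c c' x, c <= c' -> D c x -> D c' x.
Hypothesis D_entry : forall c x i j, D c x -> `|x i j| <= c.
Hypothesis D_small : exists2 L : R, 0 < L &
  forall e (x : 'M[R]_(p, q)), 0 <= e -> (forall i j, `|x i j| <= e) -> D (L * e) x.

(* Volume comparison, with volumes replaced by numbers of points of a fine
   lattice: [emb s + emb b], for [s] in a separated set and [b] in a small ball,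
   are distinct, and dividing by [16 h] with remainder sends them to pairs made
   of a point of the same small ball and a residue. *)
Lemma net_exists (h : nat) : (0 < h)%N ->
  exists s : seq 'M[R]_(p, q), [/\ (size s <= (16 * h) ^ (p * q))%N,
    forall y, y \in s -> D 2 y &
    forall x, D 1 x -> exists2 y, y \in s & D (h%:R^-1) (x - y)].
Proof.
move=> h0; have [L L0 Dsm] := D_small.
have hR : 0 < h%:R :> R by rewrite ltr0n.
have hV1 : h%:R^-1 <= 1 :> R by rewrite invf_le1 // ler1n.
have hV0 : 0 < h%:R^-1 :> R by rewrite invr_gt0.
pose eta : R := h%:R^-1; rewrite -/eta in hV1 hV0 *.
(* The lattice mesh: a matrix with entries at most [th] has [D]-radius at most L th = eta / 8. *)
pose th := eta / 8 / L; have th0 : 0 < th by rewrite !divr_gt0.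
have Lth : L * th = eta / 8 by rewrite /th; field; rewrite gt_eqF.
pose emb (z : 'M[int]_(p, q)) : 'M[R]_(p, q) := \matrix_(i, j) (th * (z i j)%:~R).
have embB z z' : emb (z - z') = emb z - emb z'.
  by apply/matrixP => i j; rewrite !mxE rmorphB /= mulrBr.
have embD z z' : emb (z + z') = emb z - - emb z'.
  by apply/matrixP => i j; rewrite !mxE rmorphD /= mulrDr opprK.
have embN z : emb (- z) = - emb z.
  by apply/matrixP => i j; rewrite !mxE rmorphN /= mulrN.
have D_opp c x : D c x -> D c (- x).
  by move/(D_scale (-1)); rewrite normrN1 mul1r scaleN1r.
have D_0 : D 0 0 by have := Dsm 0 0 (lexx _); rewrite mulr0; apply=> i j; rewrite mxE normr0.
pose K := (Num.truncn (2 / th)).+1.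
pose F (u : 'M['I_(K.*2.+1)]_(p, q)) : 'M[int]_(p, q) := \matrix_(i, j) ((u i j : nat)%:Z - K%:Z).
pose grid := [seq F u | u : 'M['I_(K.*2.+1)]_(p, q)].
have Finj : injective F.
  move=> u v /matrixP uv; apply/matrixP => i j; apply/val_inj.
  by have := uv i j; rewrite !mxE => /addIr [].
have ugrid : uniq grid by rewrite map_inj_uniq // enum_uniq.
have mgrid z : D 2 (emb z) -> z \in grid.
  move=> Dz; apply/mapP; have zK i j : `|z i j| <= K%:Z.
    have hz : `|(z i j)%:~R| <= 2 / th :> R.
      rewrite ler_pdivlMr // mulrC -{1}(gtr0_norm th0) -normrM.
      by have := D_entry i j Dz; rewrite mxE.
    rewrite -(ler_int R) intr_norm -pmulrn; apply: le_trans hz _.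
    exact/ltW/truncnS_gt.
  exists (\matrix_(i, j) inord `|z i j + K%:Z|); first by rewrite mem_enum.
  apply/matrixP => i j; have /andP[k1 k2] : - K%:Z <= z i j <= K%:Z by rewrite -ler_norml.
  have zK0 : 0 <= z i j + K%:Z by rewrite -lerBlDr sub0r.
  rewrite !mxE inordK; first by rewrite gez0_abs // addrK.
  by rewrite -ltz_nat gez0_abs // -addnn; lia.
pose ball c := [seq z <- grid | `[< D c (emb z) >]].
have uball c : uniq (ball c) by rewrite filter_uniq.
have ballP c z : c <= 2 -> (z \in ball c) <-> D c (emb z).
  move=> c2; rewrite mem_filter; split=> [/andP[/asboolP]//|Dz].
  by rewrite mgrid ?andbT; [apply/asboolP|exact: D_le Dz].
pose close z z' := `[< D (eta / 2) (emb z - emb z') >].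
have closexx : reflexive close.
  by move=> z; apply/asboolP; rewrite subrr; apply: D_le D_0; lra.
have closeC : symmetric close.
  by move=> z z'; apply/asboolP/asboolP => /D_opp; rewrite opprB.
(* Rounding moves a point by at most eta / 8, so roundings of the unit ball stay within 1 + eta / 4.
   Closeness eta / 2 then leaves a total error of 5 eta / 8. *)
have [S [SB uS sep cov]] := maximal_separated (ball (1 + eta / 4)) closexx closeC.
(* The sums emb z + emb b have radius at most 2. Dividing by Q = 16 / eta leaves eta / 8 and the
   remainder costs another eta / 8, so the quotient falls back into [Bs]. *)
pose Bs := ball (eta / 4); pose Q := (16 * h)%N.
have Q0 : (0 < Q)%N by rewrite muln_gt0.
pose G (u : 'M['I_Q]_(p, q)) : 'M[int]_(p, q) := \matrix_(i, j) (u i j : nat)%:Z.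
pose Res := [seq G u | u : 'M['I_Q]_(p, q)].
pose phi (z : 'M[int]_(p, q)) : 'M[int]_(p, q) := \matrix_(i, j) (z i j %/ Q%:Z)%Z.
pose rho (z : 'M[int]_(p, q)) : 'M[int]_(p, q) := \matrix_(i, j) (z i j %% Q%:Z)%Z.
pose f (z b : 'M[int]_(p, q)) := (phi (z + b), rho (z + b)).
have QR : Q%:R = 16 / eta :> R by rewrite natrM /eta; field; rewrite gt_eqF.
have sizeS : (size S <= (16 * h) ^ (p * q))%N.
  have B0 : (0 < size Bs)%N.
    rewrite -has_predT; apply/hasP; exists 0 => //; apply/ballP; first lra.
    have -> : emb 0 = 0 by apply/matrixP => i j; rewrite !mxE mulr0.
    by apply: D_le D_0; lra.
  have szR : size Res = ((16 * h) ^ (p * q))%N.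
    by rewrite size_map -cardE card_mx card_ord.
  rewrite -(leq_pmul2r B0) [leqRHS]mulnC -szR -(size_allpairs f S Bs) -(size_allpairs pair Bs Res).
  apply: uniq_leq_size.
    apply: allpairs_uniq; [exact: uS|exact: uball|].
    move=> [? ?] [? ?] /allpairsP[[z b] /= [zS bB [-> ->]]].
    move=> /allpairsP[[z' b'] /= [zS' bB' [-> ->]]] [/matrixP ephi /matrixP erho].
    have e : z + b = z' + b'.
      apply/matrixP => i j; have := ephi i j; have := erho i j.
      by rewrite !mxE => er ep; rewrite (divz_eq (z i j + b i j) Q%:Z) ep er -divz_eq.
    have zz : z = z'.
      apply: sep => //; apply/asboolP; rewrite -embB.
      have -> : z - z' = b' - b.
        by apply/eqP; rewrite subr_eq addrAC eq_sym subr_eq addrC -e addrC.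
      rewrite embB; have /ballP Db := bB; have /ballP Db' := bB'.
      by apply: D_le (D_sub (Db' _) (Db _)); lra.
    by move: e; rewrite zz => /addrI ->.
  move=> _ /allpairsP[[z b] /= [zS bB ->]]; apply/allpairsP.
  exists (phi (z + b), rho (z + b)); split=> //=.
    apply/ballP; first lra.
    have /ballP Dz := SB _ zS; have /ballP Db := bB.
    have Dzb : D 2 (emb (z + b)).
      rewrite embD; apply: D_le (D_sub (Dz _) (D_opp _ _ (Db _))); lra.
    have Qn0 : Q%:R != 0 :> R by rewrite pnatr_eq0 -lt0n.
    have -> : emb (phi (z + b)) = Q%:R^-1 *: emb (z + b) - Q%:R^-1 *: emb (rho (z + b)).
      apply/matrixP => i j; rewrite !mxE.
      set m := (z i j + b i j)%R.
      have em : m%:~R = (m %/ Q%:Z)%Z%:~R * Q%:R + (m %% Q%:Z)%Z%:~R :> R.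
        by rewrite {1}(divz_eq m Q%:Z) rmorphD rmorphM /= -pmulrn.
      by rewrite em; field.
    have Drho : D (L * th) (Q%:R^-1 *: emb (rho (z + b))).
      apply: Dsm => [|i j]; first exact: ltW.
      rewrite !mxE; set m := (z i j + b i j)%R.
      have m0 : 0 <= (m %% Q%:Z)%Z by rewrite modz_ge0 // -lt0n.
      have mQ : (m %% Q%:Z)%Z < Q%:Z by rewrite ltz_pmod.
      have mR0 : 0 <= (m %% Q%:Z)%Z%:~R :> R by rewrite ler0z.
      have mRQ : (m %% Q%:Z)%Z%:~R <= Q%:R :> R by rewrite pmulrn ler_int ltW.
      rewrite ger0_norm; last by rewrite mulr_ge0 ?invr_ge0 // mulr_ge0 // ltW.
      by rewrite ler_pdivrMl ?ltr0n // mulrC ler_pM2r.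
    apply: D_le (D_sub (D_scale Q%:R^-1 Dzb) Drho).
    by rewrite Lth ger0_norm ?invr_ge0 // QR invf_div; lra.
  have Qint : Q%:Z != 0 by rewrite -lt0n.
  have rQ i j : (`|rho (z + b)%R i j| < Q)%N.
    by rewrite -ltz_nat gez0_abs mxE ?modz_ge0 // ltz_pmod.
  apply/mapP; exists (\matrix_(i, j) Ordinal (rQ i j)); first by rewrite mem_enum.
  apply/matrixP => i j; rewrite [RHS]mxE [in RHS]mxE /=.
  by rewrite gez0_abs // mxE modz_ge0.
exists [seq emb z | z <- S]; split=> [|y /mapP[z zS ->]|x Dx].
- by rewrite size_map.
- have /ballP := SB _ zS; move=> Dz; apply: D_le (Dz _); lra.
pose z : 'M[int]_(p, q) := \matrix_(i, j) Num.floor (x i j / th).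
have xz : D (eta / 8) (x - emb z).
  rewrite -Lth; apply: Dsm => [|i j]; first exact: ltW.
  rewrite !mxE; have /andP[f1 f2] := floor_itv (x i j / th).
  rewrite ler_norml; apply/andP; split.
    by apply: le_trans (_ : 0 <= _); rewrite ?oppr_le0 ?(ltW th0) // subr_ge0 mulrC -ler_pdivlMr.
  rewrite lerBlDl mulrC -[X in _ + X]mul1r -mulrDl -ler_pdivrMr //.
  by move: f2; rewrite intrD => /ltW.
have zB : z \in ball (1 + eta / 4).
  apply/ballP; first lra.
  have -> : emb z = x - (x - emb z) by rewrite opprB addrC subrK.
  by apply: D_le (D_sub Dx xz); lra.
have [s sS /asboolP zs] := cov _ zB.
exists (emb s); first exact: map_f.
have -> : x - emb s = x - emb z - (emb s - emb z) by rewrite opprB addrA subrK.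
have zs' : D (eta / 2) (emb s - emb z) by rewrite -opprB; exact: D_opp.
by apply: D_le (D_sub xz zs'); lra.
Qed.
End Net.

(** * Bounds on matrices of low rank *)

Section Sampling.
Context {R : realType}.

Lemma trace_rowD n d (A : 'I_n -> 'M[R]_d) (N N' : 'M[R]_d) :
  trace_row A (N + N') = trace_row A N + trace_row A N'.
Proof. by apply/rowP => i; rewrite !mxE mulmxDr mxtraceD. Qed.

Lemma trace_rowZ n d (A : 'I_n -> 'M[R]_d) c (N : 'M[R]_d) :
  trace_row A (c *: N) = c *: trace_row A N.
Proof. by apply/rowP => i; rewrite !mxE -scalemxAr mxtraceZ. Qed.

Lemma trace_rowB n d (A : 'I_n -> 'M[R]_d) (N N' : 'M[R]_d) :
  trace_row A (N - N') = trace_row A N - trace_row A N'.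
Proof. by rewrite trace_rowD -scaleN1r trace_rowZ scaleN1r. Qed.

Lemma trace_row_bound n d (A : 'I_n -> 'M[R]_d) :
  exists2 C, 0 <= C & forall N, fnorm (trace_row A N) <= C * fnorm N.
Proof.
exists (\sum_i fnorm (A i)); first by apply: sumr_ge0 => i _; exact: fnorm_ge0.
move=> N; rewrite (row_sum_delta (trace_row A N)).
apply: le_trans (fnorm_sum _ _ _) _; rewrite mulr_suml; apply: ler_sum => i _.
rewrite fnormZ fnorm_delta mulr1 mxE -fnorm_tr -{1}(trmxK (A i)).
exact: mxdot_le.
Qed.

(** Applied to the supremum S, the self-improvement gives S <= a + S / 2. This is how an estimate on
    a net passes to the whole ball; finiteness of S must be known beforehand. *)
Lemma ubound_halving (E : set R) (a : R) : has_sup E ->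
  (forall B, ubound E B -> ubound E (a + B / 2)) -> ubound E (2 * a).
Proof.
move=> [E0 Eb] half; have supE : ubound E (sup E) by exact: sup_upper_bound.
have : sup E <= a + sup E / 2 by apply: ge_sup => //; exact: half.
by move=> h x /supE xE; apply: le_trans xE _; lra.
Qed.

(** An operator norm bound, tested on d columns at once because it is applied to the right factor of
    X Y. *)
Definition opbound d r (c : R) (X : 'M[R]_(d, r)) : Prop :=
  forall Y : 'M[R]_(r, d), fnorm (X *m Y) <= c * fnorm Y.

Lemma opbound_net d r h : (0 < d)%N -> (0 < h)%N ->
  exists s : seq 'M[R]_(d, r), [/\ (size s <= (16 * h) ^ (d * r))%N,
    forall y, y \in s -> opbound 2 y &
    forall x, opbound 1 x -> exists2 y, y \in s & opbound h%:R^-1 (x - y)].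
Proof.
move=> d0; apply: net_exists => [c c' x y xc yc Y|c t x xc Y|c c' x cc' xc Y|c x i j xc|].
- rewrite mulmxBl mulrDl; apply: le_trans (fnormB _ _) _.
  exact: lerD.
- by rewrite -scalemxAl fnormZ -mulrA ler_wpM2l.
- by apply: le_trans (xc Y) _; rewrite ler_wpM2r ?fnorm_ge0.
- have := xc (delta_mx j (Ordinal d0)); rewrite fnorm_delta mulr1; apply: le_trans.
  apply: le_trans (fnorm_entry _ i (Ordinal d0)).
  rewrite mxE (bigD1 j) //= big1 => [|k /negbTE kj]; last by rewrite mxE kj mulr0.
  by rewrite mxE !eqxx mulr1 addr0.
exists ((d * d)%:R * r%:R + 1); first by rewrite ltr_wpDl ?mulr_ge0.
move=> e x e0 xe Y; rewrite mulrDl mul1r.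
have h1 : fnorm (x *m Y) <= (d * d)%:R * (r%:R * (e * fnorm Y)).
  apply: fnorm_le_entries => i j; rewrite mxE; apply: le_trans (ler_norm_sum _ _ _) _.
  rewrite mulr_natl -[r in _ *+ r]card_ord -sumr_const; apply: ler_sum => k _.
  by rewrite normrM ler_pM ?fnorm_entry.
apply: le_trans h1 _; rewrite mulrDl !mulrA lerDl.
by rewrite mulr_ge0 ?fnorm_ge0.
Qed.

Lemma fnorm_net p q h : (0 < h)%N ->
  exists s : seq 'M[R]_(p, q), [/\ (size s <= (16 * h) ^ (p * q))%N,
    forall y, y \in s -> fnorm y <= 2 &
    forall x, fnorm x <= 1 -> exists2 y, y \in s & fnorm (x - y) <= h%:R^-1].
Proof.
apply: (net_exists (D := fun c x => fnorm x <= c)) => [c c' x y xc yc|c t x xc|c c' x cc' xc|c x i j xc|].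
- by apply: le_trans (fnormB _ _) _; exact: lerD.
- by rewrite fnormZ ler_wpM2l.
- exact: le_trans cc'.
- exact: le_trans (fnorm_entry _ _ _) xc.
exists ((p * q)%:R + 1); first by rewrite ltr_wpDl.
move=> e x e0 xe; apply: le_trans (fnorm_le_entries xe) _.
by rewrite mulrDl mul1r lerDl.
Qed.

(** X orthonormalises the columns of a rank factorisation and Y = X^T N; the projection X X^T fixes
    N, so no norm is lost. Zero columns of X allow a rank below r. *)
Lemma rank_factor d r (N : 'M[R]_d) : (\rank N <= r)%N ->
  exists (X : 'M[R]_(d, r)) (Y : 'M[R]_(r, d)),
    [/\ N = X *m Y, opbound 1 X & fnorm Y = fnorm N].
Proof.
move=> Nr.
have [V [W NVW]] : exists (V : 'M[R]_(d, r)) (W : 'M[R]_(r, d)), N = V *m W.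
  exists (col_ebase N *m pid_mx (\rank N)), (pid_mx (\rank N) *m row_ebase N).
  by rewrite mulmxA -(mulmxA (col_ebase N)) pid_mx_id // mulmx_ebase.
have [C /= [XV GG]] := gram_schmidt V; move: XV GG; move: (V *m C) => X XV GG.
have XN : X *m X^T *m N = N by rewrite NVW mulmxA XV.
exists X, (X^T *m N); split.
- by rewrite mulmxA XN.
- by move=> Y; rewrite mul1r fnorm_proj_le.
by rewrite /fnorm mxdot_mul trmxK mulmxA XN.
Qed.

End Sampling.

(** * From nets to all matrices of rank at most r *)

Section RestrictedIsometry.
Context {R : realType}.
Variables (n d r h : nat) (A : 'I_n -> 'M[R]_d) (t : R).
Variables (SX : seq 'M[R]_(d, r)) (SY : seq 'M[R]_(r, d)) (SZ : seq 'rV[R]_n).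
Hypothesis t0 : 0 <= t.
(** The fineness needed for the lower bound: with eta = 1 / h, moving to net points costs 3 eta in
    norm and 12 t eta in the image. *)
Hypothesis h_big : 400 * t + 12 <= h%:R.
Hypothesis SX2 : forall X, X \in SX -> opbound 2 X.
Hypothesis SX_net : forall X, opbound 1 X -> exists2 X', X' \in SX & opbound h%:R^-1 (X - X').
Hypothesis SY_net : forall Y, fnorm Y <= 1 -> exists2 Y', Y' \in SY & fnorm (Y - Y') <= h%:R^-1.
Hypothesis SZ_net : forall z, fnorm z <= 1 -> exists2 z', z' \in SZ & fnorm (z - z') <= 2^-1.
Hypothesis upper : forall X Y z, X \in SX -> Y \in SY -> z \in SZ ->
  mxdot z (trace_row A (X *m Y)) <= t.
Hypothesis lower : forall X Y, X \in SX -> Y \in SY ->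
  1 / 128 * fnorm (X *m Y) ^+ 2 <= fnorm (trace_row A (X *m Y)) ^+ 2.

Let hR : 0 < h%:R :> R.
Proof. by apply: lt_le_trans h_big; rewrite ltr_wpDl ?mulr_ge0. Qed.
Let eta0 : 0 < h%:R^-1 :> R. Proof. by rewrite invr_gt0. Qed.
Let eta_half : h%:R^-1 <= 2^-1 :> R.
Proof.
rewrite lef_pV2 ?posrE //; apply: le_trans h_big.
by have : 0 <= 400 * t by [rewrite mulr_ge0]; lra.
Qed.

(** Duality on a net of mesh 1/2: |v| is the pairing of v with v / |v|, hence at most t + |v| /
    2. *)
Lemma net_row_bound v : (forall z, z \in SZ -> mxdot z v <= t) -> fnorm v <= 2 * t.
Proof.
move=> vt; have [v0|vn0] := eqVneq (fnorm v) 0; first by rewrite v0 mulr_ge0.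
have v0 : 0 < fnorm v by rewrite lt_neqAle eq_sym vn0 fnorm_ge0.
have [z' z'S zz'] : exists2 z', z' \in SZ & fnorm ((fnorm v)^-1 *: v - z') <= 2^-1.
  by apply: SZ_net; rewrite fnormZ gtr0_norm ?invr_gt0 // mulVf.
have := vt _ z'S; have := mxdot_le ((fnorm v)^-1 *: v - z') v.
rewrite mxdotDl mxdotZl -sqr_fnorm expr2 mulKf // -scaleN1r mxdotZl mulN1r.
move=> /(le_trans (ler_norm _)) h1 h2.
have : fnorm ((fnorm v)^-1 *: v + -1 *: z') * fnorm v <= 2^-1 * fnorm v.
  by rewrite ler_wpM2r ?fnorm_ge0 // scaleN1r.
lra.
Qed.

Lemma trace_row_net_left X Y : X \in SX -> fnorm (trace_row A (X *m Y)) <= 4 * t * fnorm Y.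
Proof.
move=> XS; have [C C0 CA] := trace_row_bound A.
have unit_case Y' : fnorm Y' <= 1 -> fnorm (trace_row A (X *m Y')) <= 2 * (2 * t).
  pose E := [set fnorm (trace_row A (X *m Y')) | Y' in [set Y' : 'M[R]_(r, d) | fnorm Y' <= 1]].
  suff : ubound E (2 * (2 * t)) by move=> + Y1; apply; exists Y'.
  apply: ubound_halving => [|B EB _ [Y1 Y11 <-]].
    split; first by exists (fnorm (trace_row A (X *m 0))); exists 0; rewrite //= fnorm0.
    exists (C * 2) => _ [Y1 Y11 <-]; apply: le_trans (CA _) _; rewrite ler_wpM2l //.
    apply: le_trans (SX2 XS _) _; move: Y11 => /=; lra.
  have [Y2 Y2S Y12] := SY_net Y11.
  (* As the mesh is at most 1/2, twice the remainder lies in the unit ball again, which is what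
     [ubound_halving] consumes. *)
  have -> : Y1 = Y2 + 2^-1 *: (2 *: (Y1 - Y2)) by rewrite scalerA mulVf // scale1r addrC subrK.
  rewrite mulmxDr trace_rowD; apply: le_trans (fnormD _ _) _; apply: lerD.
    by apply: net_row_bound => z zS; exact: upper.
  rewrite -scalemxAr trace_rowZ fnormZ mulrC ger0_norm // ler_wpM2r //.
  apply: EB; exists (2 *: (Y1 - Y2)) => //=; rewrite fnormZ ger0_norm //.
  move: Y12 eta_half; lra.
have [Y0|Yn0] := eqVneq (fnorm Y) 0.
  by rewrite (fnorm0_eq0 Y0) mulmx0 -(scale0r (0 : 'M[R]_d)) trace_rowZ scale0r !fnorm0 mulr0.
have Y0 : 0 < fnorm Y by rewrite lt_neqAle eq_sym Yn0 fnorm_ge0.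
have := unit_case ((fnorm Y)^-1 *: Y); rewrite -scalemxAr trace_rowZ !fnormZ.
rewrite gtr0_norm ?invr_gt0 // mulVf // => /(_ (lexx _)).
rewrite ler_pdivrMl //; lra.
Qed.

(** A second halving, now over X with Y ranging over the whole ball: each of the three nets costs a
    factor 2, hence 8 t. *)
Lemma trace_row_upper (c : R) (X : 'M[R]_(d, r)) (Y : 'M[R]_(r, d)) : 0 < c -> opbound c X ->
  fnorm (trace_row A (X *m Y)) <= 8 * t * c * fnorm Y.
Proof.
move=> c0 Xc; have [C C0 CA] := trace_row_bound A.
have unit_case (X' : 'M[R]_(d, r)) (Y' : 'M[R]_(r, d)) : opbound 1 X' -> fnorm Y' <= 1 ->
    fnorm (trace_row A (X' *m Y')) <= 2 * (4 * t).
  pose E := [set fnorm (trace_row A (XY.1 *m XY.2)) | XY in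
    [set XY : 'M[R]_(d, r) * 'M[R]_(r, d) | opbound 1 XY.1 /\ fnorm XY.2 <= 1]].
  suff : ubound E (2 * (4 * t)) by move=> + X1 Y1; apply; exists (X', Y').
  apply: ubound_halving => [|B EB _ [[X1 Y1] /= [X11 Y11] <-]].
    split.
      exists (fnorm (trace_row A ((0 : 'M[R]_(d, r)) *m (0 : 'M[R]_(r, d))))); exists (0, 0) => //=; split; last by rewrite fnorm0.
      by move=> Y1; rewrite mul0mx fnorm0 mul1r fnorm_ge0.
    exists C => _ [[X1 Y1] /= [X11 Y11] <-]; apply: le_trans (CA _) _.
    rewrite -[leRHS]mulr1 ler_wpM2l //; apply: le_trans (X11 _) _.
    by rewrite mul1r.
  have [X2 X2S X12] := SX_net X11.
  have -> : X1 = X2 + 2^-1 *: (2 *: (X1 - X2)) by rewrite scalerA mulVf // scale1r addrC subrK.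
  rewrite mulmxDl trace_rowD; apply: le_trans (fnormD _ _) _; apply: lerD.
    apply: le_trans (trace_row_net_left _ X2S) _.
    by rewrite -[leRHS]mulr1 ler_wpM2l // mulr_ge0.
  rewrite -scalemxAl trace_rowZ fnormZ mulrC ger0_norm // ler_wpM2r //.
  apply: EB; exists (2 *: (X1 - X2), Y1) => //=; split=> // Y2.
  rewrite -scalemxAl fnormZ ger0_norm // mul1r.
  have := X12 Y2; have : h%:R^-1 * fnorm Y2 <= 2^-1 * fnorm Y2 by rewrite ler_wpM2r ?fnorm_ge0.
  lra.
have [Y0|Yn0] := eqVneq (fnorm Y) 0.
  by rewrite (fnorm0_eq0 Y0) mulmx0 -(scale0r (0 : 'M[R]_d)) trace_rowZ scale0r !fnorm0 mulr0.
have Y0 : 0 < fnorm Y by rewrite lt_neqAle eq_sym Yn0 fnorm_ge0.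
have := unit_case (c^-1 *: X) ((fnorm Y)^-1 *: Y).
rewrite -scalemxAr -scalemxAl !trace_rowZ !fnormZ.
rewrite gtr0_norm ?invr_gt0 // (gtr0_norm (_ : 0 < c^-1)) ?invr_gt0 // mulVf //.
move=> H; have {H} := H _ (lexx _); rewrite !ler_pdivrMl // => H.
suff : opbound 1 (c^-1 *: X) by move/H; lra.
move=> Y'; rewrite -scalemxAl fnormZ gtr0_norm ?invr_gt0 // mul1r ler_pdivrMl //.
Qed.

Lemma trace_row_rank_upper N : (\rank N <= r)%N -> fnorm (trace_row A N) <= 8 * t * fnorm N.
Proof.
move=> /rank_factor[X [Y [-> X1 YN]]]; rewrite -YN.
by have := trace_row_upper Y ltr01 X1; rewrite mulr1.
Qed.

(** Lower bounds do not pass to limits of nets by themselves: the errors of replacing X and Y by net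
    points are controlled by the upper bounds, used at radius 1 / h. *)
Lemma trace_row_rank_lower N : (\rank N <= r)%N -> 1 / 32 * fnorm N <= fnorm (trace_row A N).
Proof.
move=> Nr; have [N0|Nn0] := eqVneq (fnorm N) 0; first by rewrite N0 mulr0 fnorm_ge0.
have N0 : 0 < fnorm N by rewrite lt_neqAle eq_sym Nn0 fnorm_ge0.
have [X [Y [EN X1 YN]]] := rank_factor Nr.
wlog N1 : N Nr Nn0 N0 Y EN YN / fnorm N = 1.
  move=> /(_ ((fnorm N)^-1 *: N) _ _ _ ((fnorm N)^-1 *: Y)).
  rewrite trace_rowZ !fnormZ gtr0_norm ?invr_gt0 // mulVf // YN mulVf //.
  rewrite oner_neq0 ltr01 mulr1 ler_pdivlMl // mulrC; apply=> //.
    by rewrite mxrank_scale_nz ?invr_eq0.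
  by rewrite EN -scalemxAr.
rewrite N1 mulr1; rewrite N1 in YN.
have Y1 : fnorm Y <= 1 by rewrite YN.
have [X' X'S XX'] := SX_net X1; have [Y' Y'S YY'] := SY_net Y1.
have EXY : X' *m Y' = N - (X - X') *m Y - X' *m (Y - Y').
  by rewrite EN mulmxBl mulmxBr !subKr.
have b1 : fnorm ((X - X') *m Y) <= h%:R^-1 by have := XX' Y; rewrite YN mulr1.
have b2 : fnorm (X' *m (Y - Y')) <= 2 * h%:R^-1.
  by apply: le_trans (SX2 X'S _) _; rewrite ler_pM2l.
have b3 : fnorm (trace_row A ((X - X') *m Y)) <= 8 * t * h%:R^-1.
  by have := trace_row_upper Y eta0 XX'; rewrite YN mulr1.
have b4 : fnorm (trace_row A (X' *m (Y - Y'))) <= 4 * t * h%:R^-1.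
  by apply: le_trans (trace_row_net_left _ X'S) _; rewrite ler_wpM2l // mulr_ge0.
have c1 : 1 - 3 * h%:R^-1 <= fnorm (X' *m Y').
  have : fnorm N <= fnorm (X' *m Y') + fnorm ((X - X') *m Y) + fnorm (X' *m (Y - Y')).
    have -> : N = X' *m Y' + (X - X') *m Y + X' *m (Y - Y') by rewrite EXY addrAC !subrK.
    by apply: le_trans (fnormD _ _) _; rewrite lerD2r fnormD.
  rewrite N1; lra.
have c2 : fnorm (trace_row A (X' *m Y')) <= fnorm (trace_row A N) + 12 * t * h%:R^-1.
  rewrite EXY !trace_rowB; apply: le_trans (fnormB _ _) _.
  have := fnormB (trace_row A N) (trace_row A ((X - X') *m Y)); lra.
(* Square root of the net bound, as 1/144 <= 1/128. The result (1 - 3 eta) / 12 - 12 t eta stays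
   above 1/32. *)
have c3 : 1 / 12 * fnorm (X' *m Y') <= fnorm (trace_row A (X' *m Y')).
  rewrite -(@ler_pXn2r _ 2) ?nnegrE ?mulr_ge0 ?fnorm_ge0 //.
  apply: le_trans (lower X'S Y'S); rewrite exprMn ler_wpM2r ?sqr_ge0 //; lra.
have e1 : (400 * t + 12) * h%:R^-1 <= 1 by rewrite ler_pdivrMr // mul1r.
have e2 : 0 <= t * h%:R^-1 by rewrite mulr_ge0 // ltW.
move: eta0 e1 c2; rewrite mulrDl -!mulrA.
move: (t * _) e2 => te e2; move: (h%:R^-1) c1 => e c1 e0 e1 c2.
lra.
Qed.

End RestrictedIsometry.

(** * The random event: tails against entropy *)

Section RandomIsometry.
Context {R : realType}.

Lemma union_bound disp (T : measurableType disp) (P : probability T R)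
    (I : eqType) (s : seq I) (bad : I -> set T) (e : R) :
  (forall i, i \in s -> measurable (bad i)) ->
  (forall i, i \in s -> (P (bad i) <= e%:E)%E) ->
  exists B : set T, [/\ measurable B, (P B <= ((size s)%:R * e)%:E)%E &
    forall w i, i \in s -> bad i w -> B w].
Proof.
elim: s => [|i s IHs] mb Pb.
  by exists set0; split=> //; rewrite measure0 mul0r.
have [||B [mB PB sB]] := IHs.
- by move=> j js; apply: mb; rewrite inE js orbT.
- by move=> j js; apply: Pb; rewrite inE js orbT.
have mi : measurable (bad i) by apply: mb; rewrite mem_head.
exists (bad i `|` B); split=> [||w j].
- exact: measurableU.
  have le : (P (bad i `|` B) <= P (bad i) + P B)%E by exact: measureU2.
  apply: (le_trans le).
  by rewrite /= mulrSr mulrDl mul1r EFinD addeC leeD // Pb // mem_head.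
- by rewrite inE => /predU1P[->|/sB jB]; [left|right; exact: jB].
Qed.

Lemma natrX_expR (x : R) (b m : nat) : (0 < b)%N ->
  ln b%:R * m%:R <= x -> (b ^ m)%:R <= expR x.
Proof.
move=> b0 lex; rewrite natrX -[b%:R]lnK ?posrE ?ltr0n // -expRM_natr ler_expR.
exact: lex.
Qed.

Lemma random_isometry : exists a b c kappa : R,
  [/\ 0 < a, 0 < b, 0 < c, 0 < kappa &
  forall n d r : nat, (0 < n)%N -> (0 < d)%N -> (d * r)%:R <= kappa * n%:R ->
  forall (disp : measure_display) (T : measurableType disp)
    (P : probability T R) (A : 'I_n -> random_matrix P d),
    independent P (fun i => sigma_matrix (A i)) ->
    (forall i, gaussian_matrix (1 / n%:R) (A i)) ->
  exists E : set T, [/\ measurable E, ((1 - 2 * expR (- c * n%:R))%:E <= P E)%E &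
    forall w, E w -> forall N : 'M[R]_d, (\rank N <= r)%N ->
      a * fnorm N <= fnorm (trace_row (fun i => sample (A i) w) N) <= b * fnorm N]].
Proof.
(* On net points |z| <= 2 and |X Y| <= 4, so the upper tail has exponent t^2 / (2 * 64) = 32 per
   unit of n. This beats the net of z, of size at most 32^n <= exp ((32 - 1/32) n). *)
pose t : R := 64.
pose h := (Num.truncn (400 * t + 12)).+1.
have h_big : 400 * t + 12 <= h%:R by apply/ltW/truncnS_gt.
have h0 : (0 < h)%N by [].
clearbody h; pose G : R := ln (16 * h)%:R.
have G0 : 0 < G by rewrite ln_gt0 // ltr1n; lia.
(* The last value keeps the nets of X and Y below exp (n / 128) each. The exponents 1/64 + (32 -
   1/32) - 32 of the upper bounds and 1/64 - 1/32 of the lower ones both equal -1/64. *)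
exists (1 / 32), (8 * t), (1 / 64), (1 / 128 / G); split.
- lra.
- rewrite /t; lra.
- lra.
- by rewrite divr_gt0.
move=> n d r n0 d0 drn disp T P A indA gaussA.
have nR : 0 < n%:R :> R by rewrite ltr0n.
have drG : G * (d * r)%:R <= 1 / 128 * n%:R.
  by rewrite mulrC -ler_pdivlMr // mulrAC.
have [SX [szX SX2 SX_net]] := @opbound_net R d r h d0 h0.
have [SY [szY SY2 SY_net]] := @fnorm_net R r d h h0.
have [SZ [szZ SZ2 SZ_net]] := @fnorm_net R 1 n 2 isT.
have szX' : (size SX)%:R <= expR (1 / 128 * n%:R) :> R.
  apply: le_trans (_ : ((16 * h) ^ (d * r))%:R <= _); first by rewrite ler_nat.
  by apply: natrX_expR => //; rewrite muln_gt0.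
have szY' : (size SY)%:R <= expR (1 / 128 * n%:R) :> R.
  apply: le_trans (_ : ((16 * h) ^ (r * d))%:R <= _); first by rewrite ler_nat.
  by apply: natrX_expR; rewrite ?muln_gt0 // (mulnC r).
have szZ' : (size SZ)%:R <= expR ((32 - 1 / 32) * n%:R) :> R.
  apply: le_trans (_ : ((16 * 2) ^ (1 * n))%:R <= _); first by rewrite ler_nat.
  apply: natrX_expR => //; rewrite mul1n ler_pM2r // -[leRHS]expRK ler_ln ?posrE ?expR_gt0 //.
  by apply: le_trans (expR_ge1Dx _); rewrite natrM; lra.
have sz0 (I : Type) (s : seq I) : 0 <= (size s)%:R :> R by [].
have fin2 (x : R) : x <= 2 -> 0 <= x -> x ^+ 2 <= 4 by nra.
pose row w N := trace_row (fun i => sample (A i) w) N.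
pose sU := [seq (XY, z) | XY <- [seq (X, Y) | X <- SX, Y <- SY], z <- SZ].
have [||BU [mBU PBU hBU]] := @union_bound _ _ P _ sU
    (fun u => [set w | t <= mxdot u.2 (row w (u.1.1 *m u.1.2))]) (expR (- 32 * n%:R)).
- by move=> u _; exact: measurable_row_upper.
- move=> _ /allpairsP[[XY z] /= [/allpairsP[[X Y] /= [XS YS ->]] zS ->]] /=.
  have -> : - 32 = - (t ^+ 2 / (2 * 64)) :> R by rewrite /t; field.
  apply: (row_upper_tail n0 indA gaussA); rewrite ?/t //.
  rewrite -!sqr_fnorm.
  have z4 := fin2 _ (SZ2 _ zS) (fnorm_ge0 _).
  have XY4 : fnorm (X *m Y) <= 2 * 2.
    by apply: le_trans (SX2 _ XS _) _; rewrite ler_pM2l // SY2.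
  have := fnorm_ge0 (X *m Y); have := sqr_ge0 (fnorm z).
  have : fnorm (X *m Y) ^+ 2 <= 16 by have := fnorm_ge0 (X *m Y); nra.
  nra.
(* Zero products are left out: there the lower bound is trivial, while the event of [row_lower_tail]
   would be certain. *)
pose sL := [seq XY <- [seq (X, Y) | X <- SX, Y <- SY] | XY.1 *m XY.2 != 0].
have [||BL [mBL PBL hBL]] := @union_bound _ _ P _ sL
    (fun u => [set w | fnorm (row w (u.1 *m u.2)) ^+ 2 <= 1 / 128 * fnorm (u.1 *m u.2) ^+ 2])
    (expR (- (1 / 32) * n%:R)).
- by move=> u _; exact: measurable_row_lower.
- by move=> u; rewrite mem_filter => /andP[u0 _]; exact: (row_lower_tail n0 indA gaussA).
exists (~` (BU `|` BL)); split.
- exact/measurableC/measurableU.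
- rewrite probability_setC; last exact: measurableU.
  rewrite EFinB leeB //.
  have le : (P (BU `|` BL) <= P BU + P BL)%E by exact: measureU2.
  apply: (le_trans le); apply: le_trans (leeD PBU PBL) _.
  rewrite -EFinD lee_fin [leRHS](_ : _ = expR (- (1 / 64) * n%:R) + expR (- (1 / 64) * n%:R)); last by ring.
  apply: lerD.
    rewrite !size_allpairs !natrM.
    apply: le_trans (_ : expR (1 / 128 * n%:R) * expR (1 / 128 * n%:R) * expR ((32 - 1 / 32) * n%:R) * expR (- 32 * n%:R) <= _).
      by rewrite ler_wpM2r ?expR_ge0 // !ler_pM // mulr_ge0.
    by rewrite -!expRD ler_expR; lra.
  apply: le_trans (_ : expR (1 / 128 * n%:R) * expR (1 / 128 * n%:R) * expR (- (1 / 32) * n%:R) <= _).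
    rewrite ler_wpM2r ?expR_ge0 //.
    apply: le_trans (_ : ((size SX) * (size SY))%:R <= _).
      by rewrite ler_nat -(size_allpairs pair) size_filter count_size.
    by rewrite natrM ler_pM.
  by rewrite -!expRD ler_expR; lra.
move=> w /not_orP[nU nL] N Nr.
have t0 : 0 <= t by rewrite /t.
have upper X Y z : X \in SX -> Y \in SY -> z \in SZ -> mxdot z (row w (X *m Y)) <= t.
  move=> XS YS zS; rewrite leNgt; apply/negP => /ltW lt; apply: nU.
  by apply: (hBU w ((X, Y), z)) => //; rewrite !allpairs_f.
have lower X Y : X \in SX -> Y \in SY ->
    1 / 128 * fnorm (X *m Y) ^+ 2 <= fnorm (row w (X *m Y)) ^+ 2.
  move=> XS YS; have [XY0|XY0] := eqVneq (X *m Y) 0.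
    by rewrite XY0 fnorm0 expr0n mulr0 sqr_ge0.
  rewrite leNgt; apply/negP => /ltW lt; apply: nL.
  by apply: (hBL w (X, Y)) => //; rewrite mem_filter XY0 allpairs_f.
apply/andP; split.
  exact: (trace_row_rank_lower t0 h_big SX2 SX_net SY_net SZ_net upper lower).
exact: (trace_row_rank_upper t0 h_big SX2 SX_net SY_net SZ_net upper).
Qed.

End RandomIsometry.

(** * Matrices that are psd up to low rank *)

Section Compression.
Context {R : realType}.

Definition psd_on_perp d k (V : 'M[R]_(d, k)) (M : 'M[R]_d) : Prop :=
  forall u : 'cV[R]_d, V^T *m u = 0 -> 0 <= (u^T *m M *m u) 0 0.

Lemma projection_exists d k (V : 'M[R]_(d, k)) :
  exists (P : 'M[R]_d) (C : 'M[R]_(k, d)),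
    [/\ P = V *m C, P^T = P, P *m P = P, P *m V = V & \tr P <= k%:R].
Proof.
have [C /= [XV GG]] := gram_schmidt V.
exists (V *m C *m (V *m C)^T), (C *m (V *m C)^T); split=> //.
- by rewrite mulmxA.
- by rewrite trmx_mul trmxK.
- by rewrite [LHS]mulmxA (gram_fix GG).
- exact: trace_proj_le.
Qed.

Lemma compression_psd d k (V : 'M[R]_(d, k)) (P M : 'M[R]_d) :
  P^T = P -> P *m V = V -> M^T = M -> psd_on_perp V M ->
  psd_cone d ((1%:M - P) *m M *m (1%:M - P)).
Proof.
move=> PT PV MT Mpsd; have QT : (1%:M - P)^T = 1%:M - P by rewrite linearB /= trmx1 PT.
split=> [|v]; first by rewrite !trmx_mul MT QT mulmxA.
have := Mpsd ((1%:M - P) *m v); rewrite mulmxA -{1}QT -trmx_mul mulmxBl mul1mx PV subrr.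
by rewrite trmx0 mul0mx => /(_ erefl); rewrite trmx_mul QT !mulmxA.
Qed.

Lemma psd_trace_ge0 d (Z : 'M[R]_d) : psd_cone d Z -> 0 <= \tr Z.
Proof. by move=> /psd_factor[W ->]; rewrite -sqr_fnorm_tr sqr_ge0. Qed.

Lemma fnorm_rank1 d (v : 'cV[R]_d) : fnorm (v *m v^T) = fnorm v ^+ 2.
Proof.
apply/eqP; rewrite -(@eqrXn2 _ 2) ?fnorm_ge0 ?sqr_ge0 // (sqr_fnorm (_ *m _)); apply/eqP.
rewrite mxdot_mul mulmxA mxdotC.
have -> : v^T *m v = (fnorm v ^+ 2)%:M.
  by rewrite sqr_fnorm /mxdot trace_mx11 -mx11_scalar.
by rewrite mul_scalar_mx mxdotZl -sqr_fnorm fnorm_tr -expr2.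
Qed.

Lemma mul_tr_sum_col d e (W Z : 'M[R]_(d, e)) :
  W *m Z^T = \sum_j col j W *m (col j Z)^T.
Proof.
apply/matrixP => i l; rewrite mxE summxE; apply: eq_bigr => j _.
by rewrite !mxE big_ord1 !mxE.
Qed.

Lemma sqr_fnorm_cols d e (W : 'M[R]_(d, e)) :
  fnorm W ^+ 2 = \sum_j fnorm (col j W) ^+ 2.
Proof.
rewrite sqr_fnorm_tr mul_tr_sum_col raddf_sum; apply: eq_bigr => j _ /=.
by rewrite sqr_fnorm_tr.
Qed.

(** Triangle inequality over the rank one terms w w^T of a factorisation, for which norm and trace
    coincide. *)
Lemma psd_fnorm_le d (Z : 'M[R]_d) : psd_cone d Z -> fnorm Z <= \tr Z.
Proof.
move=> /psd_factor[W ->]; rewrite -sqr_fnorm_tr sqr_fnorm_cols mul_tr_sum_col.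
apply: le_trans (fnorm_sum _ _ _) _; apply: ler_sum => j _.
by rewrite fnorm_rank1.
Qed.

End Compression.

(** * Maurey's empirical method *)

Section Maurey.
Context {R : realType}.
Variables (n d : nat) (A : 'I_n -> 'M[R]_d) (a b : R).
Hypothesis a0 : 0 < a.

(** On the low rank matrices covered by the isometry [q] is nonnegative. Being quadratic, with polar
    form [bf], its mean at a random point is its value at the mean point plus a variance. *)
Let q (N : 'M[R]_d) := fnorm (trace_row A N) ^+ 2 - a ^+ 2 * fnorm N ^+ 2.
Let bf (M N : 'M[R]_d) := mxdot (trace_row A M) (trace_row A N) - a ^+ 2 * mxdot M N.

Let bfDr M N N' : bf M (N + N') = bf M N + bf M N'.
Proof. by rewrite /bf trace_rowD !mxdotDr; ring. Qed.

Let bfZr M c N : bf M (c *: N) = c * bf M N.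
Proof. by rewrite /bf trace_rowZ !mxdotZr; ring. Qed.

Let bf_sum M (I : finType) (F : I -> 'M[R]_d) : bf M (\sum_i F i) = \sum_i bf M (F i).
Proof.
have bf0 : bf M 0 = 0 by rewrite -(scale0r (0 : 'M[R]_d)) bfZr mul0r.
exact: (big_morph (bf M) (bfDr M) bf0).
Qed.

Let qD M N c : q (M + c *: N) = q M + 2 * c * bf M N + c ^+ 2 * q N.
Proof.
by rewrite /q /bf trace_rowD trace_rowZ !sqr_fnormD !fnormZ !mxdotZr !exprMn !real_normK ?num_real //; ring.
Qed.

Section Sampling.
Variables (I : finType) (p : I -> R) (W : I -> 'M[R]_d) (beta c : R).
Hypothesis p0 : forall i, 0 <= p i.
Hypothesis p1 : \sum_i p i = 1.
Let Wbar := \sum_i p i *: W i.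
Hypothesis qW : \sum_i p i * q (W i) - q Wbar <= beta.

(** Averaging q (X + c W_i) over i gives q (X + c Wbar) plus c^2 times the variance of q, which is
    at most beta. *)
Let replace_one (X : 'M[R]_d) L :
  (forall i, L <= q (X + c *: W i)) -> L - c ^+ 2 * beta <= q (X + c *: Wbar).
Proof.
move=> Lq; have : L <= \sum_i p i * q (X + c *: W i).
  rewrite -[L]mul1r -p1 mulr_suml; apply: ler_sum => i _; exact: ler_wpM2l.
have -> : \sum_i p i * q (X + c *: W i) =
    q (X + c *: Wbar) + c ^+ 2 * (\sum_i p i * q (W i) - q Wbar).
  rewrite (eq_bigr (fun i => p i * q X + 2 * c * bf X (p i *: W i) + c ^+ 2 * (p i * q (W i)))).
    rewrite !big_split /= -mulr_suml p1 mul1r -!mulr_sumr -bf_sum -/Wbar qD; ring.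
  by move=> i _; rewrite qD bfZr; ring.
have := ler_wpM2l (sqr_ge0 c) qW; lra.
Qed.

(* Maurey's empirical method, run in the expectation one sample at a time. *)
Lemma maurey_sampling (m : nat) (X : 'M[R]_d) L :
  (forall js : seq I, size js = m -> L <= q (X + c *: \sum_(j <- js) W j)) ->
  L - m%:R * c ^+ 2 * beta <= q (X + (m%:R * c) *: Wbar).
Proof.
elim: m X L => [|m IHm] X L Lq.
  by have := Lq [::] erefl; rewrite big_nil scaler0 !mul0r scale0r subr0.
have step i : L - m%:R * c ^+ 2 * beta <= q (X + (m%:R * c) *: Wbar + c *: W i).
  rewrite addrAC; apply: IHm => js szjs.
  by have := Lq (i :: js); rewrite /= szjs => /(_ erefl); rewrite big_cons scalerDr addrA.
have -> : X + (m.+1%:R * c) *: Wbar = X + (m%:R * c) *: Wbar + c *: Wbar.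
  by rewrite -[RHS]addrA -scalerDl -natr1 mulrDl mul1r.
apply: le_trans (replace_one step); rewrite -natr1.
by rewrite le_eqVlt; apply/orP; left; apply/eqP; ring.
Qed.

End Sampling.

Lemma rank_sum_le (I : Type) (js : seq I) (W : I -> 'M[R]_d) :
  (forall j, \rank (W j) <= 1)%N -> (\rank (\sum_(j <- js) W j)%R <= size js)%N.
Proof.
move=> W1; elim: js => [|j js IH]; first by rewrite big_nil mxrank0.
rewrite big_cons; apply: leq_trans (mxrank_add _ _) _.
by rewrite -[size _]/(1 + size js)%N leq_add.
Qed.

(** Of the rank k + k + m, the part k + k accommodates the block of M off the complement and m
    counts the samples. The condition on m makes the sampling error s^2 (a^2 + b^2) / m at most a^2
    (tr M)^2 + a^2 |M|^2 / 2. *)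
Lemma almost_psd_lower_bound (k m : nat) : (0 < k)%N ->
  4 * (a ^+ 2 + b ^+ 2) * k%:R <= a ^+ 2 * m%:R ->
  (forall N : 'M[R]_d, (\rank N <= k + k + m)%N ->
     a * fnorm N <= fnorm (trace_row A N) <= b * fnorm N) ->
  forall (V : 'M[R]_(d, k)) (M : 'M[R]_d), M^T = M -> psd_on_perp V M ->
    a ^+ 2 / 2 * fnorm M ^+ 2 <= fnorm (trace_row A M) ^+ 2 + a ^+ 2 * \tr M ^+ 2.
Proof.
move=> k0 mk isoA V M MT Mpsd; have [P [C [PVC PT PP PV trP]]] := projection_exists V.
have kR : 1 <= k%:R :> R by rewrite ler1n.
have a2 : 0 < a ^+ 2 by rewrite exprn_gt0.
have m0 : 0 < m%:R :> R.
  rewrite -(pmulr_rgt0 _ a2); apply: lt_le_trans mk.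
  by have := sqr_ge0 b; nra.
have q_ge0 N : (\rank N <= k + k + m)%N -> 0 <= q N.
  move=> /isoA/andP[aN _]; rewrite /q subr_ge0 -exprMn ler_pXn2r // ?nnegrE ?fnorm_ge0 //.
  by rewrite mulr_ge0 ?fnorm_ge0 // ltW.
set Q := 1%:M - P; set T := Q *m M *m Q; set N0 := M - T.
have Tpsd : psd_cone d T := compression_psd PT PV MT Mpsd.
have PQ : P *m Q = 0 by rewrite /Q mulmxBr mulmx1 PP subrr.
have QP : Q *m P = 0 by rewrite /Q mulmxBl mul1mx PP subrr.
have N0E : N0 = P *m M + Q *m M *m P.
  have PQ1 : P + Q = 1%:M by rewrite /Q addrC subrK.
  apply/eqP; rewrite /N0 /T subr_eq -addrA -mulmxDr PQ1 mulmx1 -mulmxDl PQ1 mul1mx.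
  exact: eqxx.
have rP : (\rank P <= k)%N by rewrite PVC; apply: leq_trans (mxrankM_maxl _ _) (rank_leq_col _).
have rN0 : (\rank N0 <= k + k)%N.
  rewrite N0E; apply: leq_trans (mxrank_add _ _) (leq_add _ _).
    exact: leq_trans (mxrankM_maxl _ _) rP.
  exact: leq_trans (mxrankM_maxr _ _) rP.
have EM : M = N0 + T by rewrite /N0 subrK.
have fP : fnorm P ^+ 2 <= k%:R by rewrite sqr_fnorm /mxdot PT PP.
have [Z EZ] := psd_factor Tpsd; set s := \tr T.
have s0 : 0 <= s := psd_trace_ge0 Tpsd.
(* The trace s is tr M minus the pairing of P with M, and |P|^2 = tr P <= k. *)
have s2 : s ^+ 2 <= 2 * \tr M ^+ 2 + 2 * k%:R * fnorm M ^+ 2.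
  have sE : s = \tr M - mxdot P M.
    rewrite /s /T mxtrace_mulC mulmxA.
    have -> : Q *m Q = Q by rewrite {1}/Q mulmxBl mul1mx PQ subr0.
    by rewrite /Q mulmxBl mul1mx raddfB /= /mxdot PT.
  have cs : mxdot P M ^+ 2 <= k%:R * fnorm M ^+ 2.
    have := mxdot_le P M; rewrite -(@ler_pXn2r _ 2) ?nnegrE ?mulr_ge0 ?fnorm_ge0 //.
    rewrite real_normK ?num_real // exprMn => /le_trans; apply.
    by rewrite ler_wpM2r ?sqr_ge0.
  rewrite sE; have := sqr_ge0 (\tr M + mxdot P M); nra.
have main : - (s ^+ 2 * (a ^+ 2 + b ^+ 2)) <= m%:R * q M.
  (* The sampling weights divide by s; if s = 0, then T = 0 and M itself has low rank. *)
  have [s00|sn0] := eqVneq s 0.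
    rewrite s00 expr0n mul0r oppr0 mulr_ge0 ?(ltW m0) //; apply: q_ge0.
    have T0 : T = 0.
      apply: fnorm0_eq0; apply/eqP; rewrite eq_le fnorm_ge0 andbT -s00.
      exact: psd_fnorm_le.
    by rewrite EM T0 addr0; apply: leq_trans rN0 (leq_addr _ _).
  have spos : 0 < s by rewrite lt_neqAle eq_sym sn0.
  (* Each term of T is normalised to norm 1 and drawn with probability proportional to its trace; a
     zero column has weight 0. *)
  pose v j := col j Z; pose p j := fnorm (v j) ^+ 2 / s.
  pose W j := (fnorm (v j) ^+ 2)^-1 *: (v j *m (v j)^T).
  have p0 j : 0 <= p j by rewrite divr_ge0 ?sqr_ge0.
  have p1 : \sum_j p j = 1.
    by rewrite -mulr_suml -sqr_fnorm_cols sqr_fnorm_tr -EZ divff.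
  have pW : \sum_j p j *: W j = s^-1 *: T.
    rewrite EZ mul_tr_sum_col scaler_sumr; apply: eq_bigr => j _.
    rewrite /p /W scalerA; have [v0|v0] := eqVneq (fnorm (v j)) 0.
      by rewrite -/(v j) (fnorm0_eq0 v0) mul0mx !scaler0.
    by congr (_ *: _); field; rewrite sn0.
  have W1 j : fnorm (W j) <= 1.
    rewrite /W fnormZ fnorm_rank1 ger0_norm ?invr_ge0 ?sqr_ge0 //.
    have [->|v0] := eqVneq (fnorm (v j)) 0; first by rewrite expr0n mulr0.
    by rewrite mulVf // expf_neq0.
  have rW j : (\rank (W j) <= 1)%N.
    apply: leq_trans (mxrank_scale _ _) _.
    exact: leq_trans (mxrankM_maxl _ _) (rank_leq_col _).
  have sq1 (x : R) : 0 <= x -> x <= 1 -> x ^+ 2 <= 1 by nra.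
  (* The upper isometry bound on rank one gives b^2; a^2 bounds - q at the mean, whose norm is at
     most 1. *)
  have qW : \sum_j p j * q (W j) - q (\sum_j p j *: W j) <= a ^+ 2 + b ^+ 2.
    rewrite addrC; apply: lerD.
      rewrite /q opprB; apply: le_trans (_ : a ^+ 2 * fnorm (\sum_j p j *: W j) ^+ 2 <= _).
        by rewrite gerBl sqr_ge0.
      rewrite -[leRHS]mulr1 ler_wpM2l ?sqr_ge0 // sq1 ?fnorm_ge0 //.
      apply: le_trans (fnorm_sum _ _ _) _; rewrite -p1; apply: ler_sum => j _.
      by rewrite fnormZ ger0_norm // ler_piMr.
    rewrite -[leRHS]mul1r -p1 mulr_suml; apply: ler_sum => j _; apply: ler_wpM2l => //.
    apply: le_trans (_ : fnorm (trace_row A (W j)) ^+ 2 <= _).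
      by rewrite /q gerBl mulr_ge0 ?sqr_ge0.
    have /andP[_ bW] : a * fnorm (W j) <= fnorm (trace_row A (W j)) <= b * fnorm (W j).
      apply: isoA; apply: leq_trans (rW j) _; lia.
    apply: le_trans (_ : (b * fnorm (W j)) ^+ 2 <= _).
      by rewrite ler_pXn2r // ?nnegrE ?fnorm_ge0 //; apply: le_trans bW; exact: fnorm_ge0.
    by rewrite exprMn -[leRHS]mulr1 ler_wpM2l ?sqr_ge0 // sq1 ?fnorm_ge0.
  have := maurey_sampling p0 p1 (c := s / m%:R) qW (m := m) (X := N0) (L := 0).
  have -> : (m%:R * (s / m%:R)) *: (\sum_j p j *: W j) = T.
    rewrite pW scalerA (_ : _ * _ = 1) ?scale1r //; field.
    by rewrite sn0 gt_eqF.
  rewrite -EM => H.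
  have {H} : 0 - m%:R * (s / m%:R) ^+ 2 * (a ^+ 2 + b ^+ 2) <= q M.
    apply: H => js szjs; apply: q_ge0; apply: leq_trans (mxrank_add _ _) _.
    apply: leq_add => //; apply: leq_trans (mxrank_scale _ _) _.
    by rewrite -szjs rank_sum_le.
  rewrite sub0r -(ler_pM2l m0); apply: le_trans.
  by rewrite le_eqVlt; apply/orP; left; apply/eqP; field; rewrite gt_eqF.
rewrite /q in main.
have hb : s ^+ 2 * (a ^+ 2 + b ^+ 2) <= m%:R * (a ^+ 2 * \tr M ^+ 2 + a ^+ 2 / 2 * fnorm M ^+ 2).
  have f2 := sqr_ge0 (fnorm M); have t2 := sqr_ge0 (\tr M); have b2 := sqr_ge0 b.
  have ab0 : 0 <= a ^+ 2 + b ^+ 2 by nra.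
  apply: le_trans (ler_wpM2r ab0 s2) _.
  have h1 : 4 * (a ^+ 2 + b ^+ 2) <= a ^+ 2 * m%:R by nra.
  have h2 := ler_wpM2r t2 h1; have h3 := ler_wpM2r f2 mk.
  have h4 : 0 <= a ^+ 2 * m%:R * \tr M ^+ 2 by rewrite mulr_ge0 // mulr_ge0 // ltW.
  nra.
rewrite -(ler_pM2l m0).
move: main hb; lra.
Qed.

End Maurey.

(** * Image cones and their tangent spaces *)

Section NormTopology.
Context {R : realType}.

Lemma closure_normP (V : normedModType R) (S : set V) (x : V) :
  closure S x <-> forall e : R, 0 < e -> exists2 y, S y & `|x - y| < e.
Proof.
split=> [Sx e e0|Sx B /nbhs_ballP[e /= e0 eB]].
  have [|y [Sy]] := Sx (ball x e); first exact: nbhsx_ballx.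
  by rewrite -ball_normE /= => xy; exists y.
by have [y Sy xy] := Sx e e0; exists y; split=> //; apply: eB; rewrite -ball_normE.
Qed.

Lemma lipschitz_continuous_fun (V W : normedModType R) (f : V -> W) (K : R) :
  (forall x y, `|f x - f y| <= K * `|x - y|) -> continuous f.
Proof.
move=> fK x; apply/cvgrPdist_lt => e e0.
have K0 : 0 < `|K| + 1 by rewrite ltr_wpDl.
apply/nbhs_normP; exists (e / (`|K| + 1)); first by rewrite /= divr_gt0.
move=> y /= xy; apply: le_lt_trans (fK x y) _.
apply: le_lt_trans (_ : (`|K| + 1) * `|x - y| < e).
  by rewrite ler_wpM2r // ler_wpDr // ler_norm.
by rewrite mulrC -ltr_pdivlMr.
Qed.

Lemma rV_norm_entry m (u : 'rV[R]_m) i j : `|u i j| <= `|u|.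
Proof.
rewrite [leRHS]/Num.norm /= mx_normrE; apply/bigmax_geP; right => /=.
by exists (i, j).
Qed.

Lemma rV_norm_le m (u : 'rV[R]_m) (e : R) : 0 <= e ->
  (forall j, `|u 0 j| <= e) -> `|u| <= e.
Proof.
move=> e0 ue; rewrite [leLHS]/Num.norm /= mx_normrE; apply/bigmax_leP; split=> // -[i j] _ /=.
by rewrite ord1.
Qed.

Lemma rV_norm_fnorm m (u : 'rV[R]_m) : `|u| <= fnorm u.
Proof. by apply: rV_norm_le => [|j]; [exact: fnorm_ge0|exact: fnorm_entry]. Qed.

Lemma rV_fnorm_norm m (u : 'rV[R]_m) : fnorm u <= m%:R * `|u|.
Proof.
by rewrite -[m in m%:R]mul1n; apply: fnorm_le_entries => i j; exact: rV_norm_entry.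
Qed.

Lemma fnorm_mxvec p q (X : 'M[R]_(p, q)) : fnorm (mxvec X) = fnorm X.
Proof.
congr Num.sqrt; rewrite !mxdotE big_ord1 pair_bigA /=.
rewrite (reindex _ (curry_mxvec_bij p q)) /=.
by apply: eq_bigr => -[i j] _ /=; rewrite mxvecE.
Qed.

Lemma fnorm_vec_mx p q (u : 'rV[R]_(p * q)) : fnorm (vec_mx u) = fnorm u.
Proof. by rewrite -[in RHS](vec_mxK u) fnorm_mxvec. Qed.

Lemma fnorm_dist p q (X Y : 'M[R]_(p, q)) : `|fnorm X - fnorm Y| <= fnorm (X - Y).
Proof.
have := fnormD (X - Y) Y; have := fnormD (Y - X) X.
rewrite !subrK -[fnorm (Y - X)]fnormN opprB ler_norml; lra.
Qed.

(** The topology of row vectors comes from the maximum norm, which is equivalent to [fnorm]. *)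
Lemma closure_fnormP m (S : set 'rV[R]_m) (x : 'rV[R]_m) :
  closure S x <-> forall e : R, 0 < e -> exists2 y, S y & fnorm (x - y) < e.
Proof.
split=> [/closure_normP Sx e e0|Sx]; last first.
  apply/closure_normP => e /Sx[y Sy xy]; exists y => //.
  exact: le_lt_trans (rV_norm_fnorm _) xy.
have m0 : 0 < m%:R + 1 :> R by rewrite ltr_wpDl.
have [y Sy xy] := Sx (e / (m%:R + 1)) (divr_gt0 e0 m0); exists y => //.
apply: le_lt_trans (rV_fnorm_norm _) _.
move: xy; rewrite ltr_pdivlMr // mulrDr mulr1 mulrC; apply: le_lt_trans.
by rewrite lerDl.
Qed.

End NormTopology.

Section ClosedImage.
Context {R : realType}.
Variables (d m : nat) (f : 'M[R]_d -> 'rV[R]_m) (K : R).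
Hypothesis fB : forall X Y, f (X - Y) = f X - f Y.
Hypothesis fK : forall X, fnorm (f X) <= K * fnorm X.

(** Coercivity on S confines near-preimages of z to a compact set, where the distance to z attains
    its minimum; that minimum is 0. Matrices are vectorised for the extreme value theorem on row
    vectors. *)
Lemma closed_image (S : set 'M[R]_d) (L : R) :
  (forall X, (forall e : R, 0 < e -> exists2 Y, S Y & fnorm (X - Y) < e) -> S X) ->
  (forall X, S X -> fnorm X <= L * fnorm (f X)) -> closed (f @` S).
Proof.
move=> Scl SL z /closure_fnormP zS.
(* A point of S whose image is within 1 of z has norm at most [rho]. *)
pose rho := `|L| * (fnorm z + 1).
pose B := [set u : 'rV[R]_(d * d) | S (vec_mx u) /\ fnorm u <= rho].
have inB X : S X -> fnorm (z - f X) < 1 -> B (mxvec X).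
  move=> SX zX; split; rewrite ?mxvecK // fnorm_mxvec.
  apply: le_trans (SL _ SX) _; apply: le_trans (ler_wpM2r (fnorm_ge0 _) (ler_norm L)) _.
  apply: ler_wpM2l => //.
  have := fnormB z (z - f X); rewrite subKr; move/le_trans; apply.
  by rewrite lerD2l ltW.
have fcont u v : `|fnorm (z - f (vec_mx u)) - fnorm (z - f (vec_mx v))| <=
    (`|K| * (d * d)%:R) * `|u - v|.
  apply: le_trans (fnorm_dist _ _) _; rewrite opprB addrC addrA subrK -fB -linearB /=.
  apply: le_trans (fK _) _; rewrite fnorm_vec_mx distrC -mulrA.
  apply: le_trans (ler_wpM2r (fnorm_ge0 _) (ler_norm K)) _.
  by rewrite ler_wpM2l // rV_fnorm_norm.
have [c] : exists2 c, c \in B & forall t, t \in B ->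
    fnorm (z - f (vec_mx c)) <= fnorm (z - f (vec_mx t)).
  apply: EVT_min_rV.
  - have [y [X SX <-] zX] := zS 1 ltr01; exists (mxvec X); exact: inB.
  - apply: bounded_closed_compact.
      exists rho; split; first exact: num_real.
      move=> M rhoM u [_ ur]; apply: le_trans (rV_norm_fnorm u) _.
      exact: le_trans ur (ltW rhoM).
    move=> u /closure_fnormP uB; split.
      apply: Scl => e /uB[v [Sv _] uv].
      by exists (vec_mx v) => //; rewrite -linearB /= fnorm_vec_mx.
    rewrite leNgt; apply/negP => ru.
    have [|v [_ vr] uv] := uB (fnorm u - rho); first by rewrite subr_gt0.
    have := fnormD (u - v) v; rewrite subrK; lra.
  - apply: continuous_subspaceT; apply: (@lipschitz_continuous_fun R _ R^o); exact: fcont.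
move=> /set_mem[Sc _] cmin; exists (vec_mx c) => //.
apply/esym/eqP; rewrite -subr_eq0; apply/eqP/fnorm0_eq0/eqP.
rewrite eq_le fnorm_ge0 andbT leNgt; apply/negP => g0.
have [|_ [X SX <-]] := zS (Num.min 1 (fnorm (z - f (vec_mx c)))).
  by rewrite lt_min ltr01.
rewrite lt_min => /andP[z1]; rewrite ltNge => /negP; apply.
by have := cmin (mxvec X) (mem_set (inB _ SX z1)); rewrite mxvecK.
Qed.

End ClosedImage.

(** * The positive semidefinite cone and its tangent spaces *)

Section PsdCone.
Context {R : realType}.

Lemma quad_formZ d (u : 'cV[R]_d) (X : 'M[R]_d) (v : 'cV[R]_d) c :
  (u^T *m (c *: X) *m v) 0 0 = c * (u^T *m X *m v) 0 0.
Proof. by rewrite -scalemxAr -scalemxAl mxE. Qed.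

Lemma psd_coneD d (X Y : 'M[R]_d) : psd_cone d X -> psd_cone d Y -> psd_cone d (X + Y).
Proof.
move=> [XT Xp] [YT Yp]; split=> [|v]; first by rewrite linearD /= XT YT.
by rewrite mulmxDr mulmxDl mxE addr_ge0.
Qed.

Lemma psd_coneZ d c (X : 'M[R]_d) : 0 <= c -> psd_cone d X -> psd_cone d (c *: X).
Proof.
move=> c0 [XT Xp]; split=> [|v]; first by rewrite linearZ /= XT.
by rewrite quad_formZ mulr_ge0.
Qed.

Lemma psd_cone0 d : psd_cone d (0 : 'M[R]_d).
Proof. by split=> [|v]; rewrite ?trmx0 // mulmx0 mul0mx mxE. Qed.

Lemma psd_cone_sum d (I : Type) (r : seq I) (Q : pred I) (F : I -> 'M[R]_d) :
  (forall i, psd_cone d (F i)) -> psd_cone d (\sum_(i <- r | Q i) F i).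
Proof.
by move=> Fp; elim/big_ind: _ => //; [exact: psd_cone0|exact: psd_coneD].
Qed.

Lemma psd_cone_gram d e (W : 'M[R]_(d, e)) : psd_cone d (W *m W^T).
Proof.
split=> [|v]; first by rewrite trmx_mul trmxK.
rewrite mulmxA -mulmxA -[v in W^T *m v]trmxK -trmx_mul -trace_mx11 -sqr_fnorm_tr.
exact: sqr_ge0.
Qed.

(* The convex tangent space of the positive semidefinite cone at [V *m V^T]. *)
Definition tangent_mx d k (V : 'M[R]_(d, k)) : set 'M[R]_d :=
  [set N | N^T = N /\ forall u : 'cV[R]_d, V^T *m u = 0 -> (u^T *m N *m u) 0 0 = 0].

(** With Q = 1 - P, both Q N Q and its negative are psd, so Q N Q has trace 0 and vanishes. What
    remains is N = P N + N P - P N P. *)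
Lemma tangent_mxE d k (V : 'M[R]_(d, k)) (N : 'M[R]_d) :
  tangent_mx V N <-> exists G : 'M[R]_(d, k), N = V *m G^T + G *m V^T.
Proof.
split=> [[NT N0]|[G ->]]; last first.
  split=> [|u Vu]; first by rewrite linearD /= !trmx_mul !trmxK addrC.
  have uV : u^T *m V = 0 by rewrite -[V]trmxK -trmx_mul Vu trmx0.
  by rewrite mulmxDr mulmxDl -!mulmxA Vu !mulmxA uV !mul0mx !mulmx0 addr0 mxE.
have [P [C [PVC PT PP PV _]]] := projection_exists V.
have psd1 : psd_cone d ((1%:M - P) *m N *m (1%:M - P)).
  by apply: (compression_psd PT PV NT) => u /N0 ->.
have psd2 : psd_cone d ((1%:M - P) *m (- N) *m (1%:M - P)).
  apply: (compression_psd PT PV); first by rewrite linearN /= NT.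
  by move=> u /N0 u0; rewrite mulmxN mulNmx mxE u0 oppr0.
have Q0 : (1%:M - P) *m N *m (1%:M - P) = 0.
  apply: fnorm0_eq0; apply/eqP; rewrite eq_le fnorm_ge0 andbT.
  apply: le_trans (psd_fnorm_le psd1) _; rewrite -oppr_ge0 -raddfN /=.
  by have := psd_trace_ge0 psd2; rewrite mulmxN mulNmx.
have NE : N = P *m N + N *m P - P *m N *m P.
  have QN : (1%:M - P) *m N = (1%:M - P) *m N *m P.
    by rewrite -[LHS]mulmx1 -{2}(subrK P 1%:M) mulmxDr Q0 add0r.
  move: QN; rewrite !mulmxBl mul1mx => /eqP; rewrite subr_eq => /eqP {1}->.
  by rewrite addrC addrA.
(* Half of P N P is assigned to each of the two terms, so that they are transposes of each other. *)
pose N' := N - 2^-1 *: (N *m P).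
have N'T : N'^T = N - 2^-1 *: (P *m N).
  by rewrite /N' linearB linearZ /= trmx_mul PT NT.
have PN' : V *m (C *m N') = P *m N - 2^-1 *: (P *m N *m P).
  by rewrite mulmxA -PVC /N' mulmxBr -scalemxAr mulmxA.
have N'P : (C *m N')^T *m V^T = N *m P - 2^-1 *: (P *m N *m P).
  by rewrite -trmx_mul mulmxA -PVC trmx_mul N'T PT mulmxBl -scalemxAl.
exists (C *m N')^T; rewrite trmxK PN' N'P {1}NE addrACA -opprD -scalerDl.
by rewrite (_ : 2^-1 + 2^-1 = 1 :> R) ?scale1r //; field.
Qed.

Lemma tangent_mxD d k (V : 'M[R]_(d, k)) N N' :
  tangent_mx V N -> tangent_mx V N' -> tangent_mx V (N + N').
Proof.
move=> [NT N0] [NT' N0']; split=> [|u Vu]; first by rewrite linearD /= NT NT'.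
by rewrite mulmxDr mulmxDl mxE N0 // N0' // addr0.
Qed.

Lemma tangent_mxN d k (V : 'M[R]_(d, k)) N : tangent_mx V N -> tangent_mx V (- N).
Proof.
move=> [NT N0]; split=> [|u Vu]; first by rewrite linearN /= NT.
by rewrite mulmxN mulNmx mxE N0 // oppr0.
Qed.

Lemma tangent_mx0 d k (V : 'M[R]_(d, k)) : tangent_mx V 0.
Proof. by split=> [|u _]; rewrite ?trmx0 // mulmx0 mul0mx mxE. Qed.

Lemma mx_form_le d (u : 'cV[R]_d) (X : 'M[R]_d) :
  `|(u^T *m X *m u) 0 0| <= fnorm u ^+ 2 * fnorm X.
Proof.
have -> : (u^T *m X *m u) 0 0 = mxdot X^T (u *m u^T).
  by rewrite /mxdot trmxK mulmxA mxtrace_mulC mulmxA trace_mx11.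
by apply: le_trans (mxdot_le _ _) _; rewrite fnorm_tr fnorm_rank1 mulrC.
Qed.

Lemma symmetric_closure d (S : set 'M[R]_d) (X : 'M[R]_d) :
  (forall Y, S Y -> Y^T = Y) ->
  (forall e : R, 0 < e -> exists2 Y, S Y & fnorm (X - Y) < e) -> X^T = X.
Proof.
move=> ST XS; apply/eqP; rewrite -subr_eq0; apply/eqP/fnorm0_eq0/eqP.
rewrite eq_le fnorm_ge0 andbT leNgt; apply/negP => g0.
have [|Y SY XY] := XS (fnorm (X^T - X) / 2); first by rewrite divr_gt0.
have := fnormB (X - Y)^T (X - Y); rewrite fnorm_tr linearB /= (ST _ SY).
rewrite opprB addrA subrK; lra.
Qed.

Lemma form_closure d (S : set 'M[R]_d) (X : 'M[R]_d) (u : 'cV[R]_d) e :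
  (forall e : R, 0 < e -> exists2 Y, S Y & fnorm (X - Y) < e) -> 0 < e ->
  exists2 Y, S Y & `|(u^T *m X *m u) 0 0 - (u^T *m Y *m u) 0 0| < e.
Proof.
move=> XS e0; have c0 : 0 < fnorm u ^+ 2 + 1 by rewrite ltr_wpDl ?sqr_ge0.
have [Y SY XY] := XS (e / (fnorm u ^+ 2 + 1)) (divr_gt0 e0 c0); exists Y => //.
have -> : (u^T *m X *m u) 0 0 - (u^T *m Y *m u) 0 0 = (u^T *m (X - Y) *m u) 0 0.
  by rewrite mulmxBr mulmxBl [in RHS]mxE [in X in _ = _ + X]mxE.
apply: le_lt_trans (mx_form_le _ _) _.
move: XY; rewrite ltr_pdivlMr // mulrDr mulr1 mulrC; apply: le_lt_trans.
by rewrite lerDl fnorm_ge0.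
Qed.

End PsdCone.

(** * The image of the psd cone under [trace_map] *)

Section TraceMap.
Context {R : realType}.
Variables (n d : nat) (A : 'I_n -> 'M[R]_d).
Let B := trace_map A.

Lemma trace_mapD X Y : B (X + Y) = B X + B Y.
Proof.
rewrite /B /trace_map add_row_mx; congr row_mx; apply/rowP => i; rewrite !mxE.
  by rewrite mulmxDr mxtraceD.
by rewrite mxtraceD.
Qed.

Lemma trace_mapZ c X : B (c *: X) = c *: B X.
Proof.
rewrite /B /trace_map scale_row_mx; congr row_mx; apply/rowP => i; rewrite !mxE.
  by rewrite -scalemxAr mxtraceZ.
by rewrite mxtraceZ.
Qed.

Lemma trace_mapB X Y : B (X - Y) = B X - B Y.
Proof. by rewrite trace_mapD -scaleN1r trace_mapZ scaleN1r. Qed.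

Lemma trace_map0 : B 0 = 0.
Proof. by rewrite -(scale0r (0 : 'M[R]_d)) trace_mapZ scale0r. Qed.

Lemma trace_mapN X : B (- X) = - B X.
Proof. by rewrite -(sub0r X) trace_mapB trace_map0 sub0r. Qed.

Lemma trace_map_sum (I : Type) (r : seq I) (Q : pred I) (F : I -> 'M[R]_d) :
  B (\sum_(i <- r | Q i) F i) = \sum_(i <- r | Q i) B (F i).
Proof. exact: (big_morph B trace_mapD trace_map0). Qed.

Lemma sqr_fnorm_trace_map X : fnorm (B X) ^+ 2 = fnorm (trace_row A X) ^+ 2 + \tr X ^+ 2.
Proof.
rewrite sqr_fnorm mxdotE big_ord1 big_split_ord /= big_ord1; congr (_ + _).
  rewrite sqr_fnorm mxdotE big_ord1; apply: eq_bigr => i _.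
  by rewrite /B /trace_map row_mxEl !mxE.
by rewrite /B /trace_map row_mxEr !mxE expr2.
Qed.

Lemma trace_map_bound : exists2 K, 0 <= K & forall X, fnorm (B X) <= K * fnorm X.
Proof.
have [C C0 CA] := trace_row_bound A.
exists (C + fnorm (1%:M : 'M[R]_d)); first by rewrite addr_ge0 ?fnorm_ge0.
move=> X; have K0 : 0 <= C + fnorm (1%:M : 'M[R]_d) by rewrite addr_ge0 ?fnorm_ge0.
rewrite -(@ler_pXn2r _ 2) ?nnegrE ?mulr_ge0 ?fnorm_ge0 // sqr_fnorm_trace_map.
have h1 : fnorm (trace_row A X) ^+ 2 <= (C * fnorm X) ^+ 2.
  by rewrite ler_pXn2r ?nnegrE ?mulr_ge0 ?fnorm_ge0.
have h2 : \tr X ^+ 2 <= (fnorm (1%:M : 'M[R]_d) * fnorm X) ^+ 2.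
  rewrite -[\tr X ^+ 2]real_normK ?num_real // ler_pXn2r ?nnegrE ?mulr_ge0 ?fnorm_ge0 //.
  by have := mxdot_le 1%:M X; rewrite /mxdot trmx1 mul1mx.
apply: le_trans (lerD h1 h2) _; rewrite mulrDl [leRHS]sqrrD.
by rewrite -addrA lerD2l lerDr mulrn_wge0 // !mulr_ge0 ?fnorm_ge0.
Qed.

Lemma trace_le_trace_map X : `|\tr X| <= fnorm (B X).
Proof.
rewrite -(@ler_pXn2r _ 2) ?nnegrE ?fnorm_ge0 // real_normK ?num_real //.
by rewrite sqr_fnorm_trace_map lerDr sqr_ge0.
Qed.

(** The last coordinate alone gives injectivity at 0 on the psd cone, with a constant, whatever the
    matrices A are. *)
Lemma psd_fnorm_le_trace_map X : psd_cone d X -> fnorm X <= fnorm (B X).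
Proof.
move=> Xp; apply: le_trans (psd_fnorm_le Xp) _.
exact: le_trans (ler_norm _) (trace_le_trace_map X).
Qed.

Let C := B @` psd_cone d.

Lemma closed_psd_image : closed C.
Proof.
have [K K0 BK] := trace_map_bound.
apply: (@closed_image R d _ B K trace_mapB BK _ 1); last first.
  by move=> X; rewrite mul1r; exact: psd_fnorm_le_trace_map.
move=> X XS; split; first by apply: (symmetric_closure _ XS) => Y [].
move=> v; rewrite leNgt; apply/negP => v0.
have [|Y [_ /(_ v) Yv]] := form_closure v XS (e := - (v^T *m X *m v) 0 0).
  by rewrite oppr_gt0.
rewrite ler0_norm; last by rewrite subr_le0 (le_trans (ltW v0)).
by rewrite opprB ltrBlDl subrr ltNge Yv.
Qed.

Lemma convex_cone_psd_image : convex_cone C.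
Proof.
have CD x y : C x -> C y -> C (x + y).
  by move=> [X Xp <-] [Y Yp <-]; exists (X + Y); [exact: psd_coneD|exact: trace_mapD].
have CZ c x : 0 <= c -> C x -> C (c *: x).
  by move=> c0 [X Xp <-]; exists (c *: X); [exact: psd_coneZ|exact: trace_mapZ].
split=> //; first by exists 0; [exact: psd_cone0|exact: trace_map0].
apply/convex_setW => x y; rewrite !inE => Cx Cy k k0 k1.
by rewrite inE; apply: CD; apply: CZ => //=; rewrite subr_ge0 ltW.
Qed.

Lemma pointed_psd_image : pointed_cone C.
Proof.
apply/seteqP; split=> [x [[X Xp XE] [_ [Y Yp <-] YE]]|x ->]; last first.
  have C0 : C 0 by exists 0; [exact: psd_cone0|exact: trace_map0].
  by split=> //; exists 0 => //; rewrite oppr0.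
have XY : B (X + Y) = 0 by rewrite trace_mapD XE -YE addNr.
have := trace_le_trace_map (X + Y); rewrite XY fnorm0 normr_le0 mxtraceD => /eqP trXY.
have X0 : X = 0.
  apply: fnorm0_eq0; apply/eqP; rewrite eq_le fnorm_ge0 andbT.
  apply: le_trans (psd_fnorm_le Xp) _.
  by have := psd_trace_ge0 Yp; have := psd_trace_ge0 Xp; move: trXY; lra.
by rewrite /= -XE X0 trace_map0.
Qed.

(** A preimage is a sum of rank one psd matrices, and the face property puts each of their images on
    the ray of x; a nonzero one is rescaled to x. *)
Lemma extreme_ray_rank1 x : extreme_ray_generator C x ->
  exists v : 'cV[R]_d, x = B (v *m v^T).
Proof.
move=> [[X Xp XE] x0 face]; have [W XW] := psd_factor Xp.
pose y j := B (col j W *m (col j W)^T).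
have xE : x = \sum_j y j by rewrite -trace_map_sum -mul_tr_sum_col -XW.
have [j yj0] : exists j, y j != 0.
  apply/existsP; rewrite -negb_forall; apply: contra x0 => /forallP y0.
  by rewrite xE big1 // => j _; apply/eqP/y0.
have [|||[a /= a0 axy] _] := face (y j) (\sum_(l | l != j) y l).
- by exists (col j W *m (col j W)^T) => //; exact: psd_cone_gram.
- exists (\sum_(l | l != j) col l W *m (col l W)^T); last by rewrite trace_map_sum.
  by apply: psd_cone_sum => l; exact: psd_cone_gram.
- by exists 1; rewrite /= ?ler01 // scale1r xE [in LHS](bigD1 j).
have an0 : a != 0 by apply: contra yj0 => /eqP a00; rewrite -axy a00 scale0r.
exists (Num.sqrt a^-1 *: col j W).
rewrite linearZ /= -scalemxAl -scalemxAr scalerA -expr2 sqr_sqrtr ?invr_ge0 //.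
by rewrite trace_mapZ -/(y j) -axy scalerA mulVf // scale1r.
Qed.

Section Tangent.
Variables (k : nat) (V : 'M[R]_(d, k)) (K : R).
Hypothesis K0 : 0 <= K.
Hypothesis BV : forall M, M^T = M -> psd_on_perp V M -> fnorm M <= K * fnorm (B M).

Lemma closed_tangent_image : closed (B @` tangent_mx V).
Proof.
have [K1 K10 BK] := trace_map_bound.
apply: (@closed_image R d _ B K1 trace_mapB BK _ K); last first.
  by move=> N [NT N0]; apply: BV => // u /N0 ->.
move=> X XS; split; first by apply: (symmetric_closure _ XS) => Y [].
move=> u Vu; apply/eqP; rewrite -normr_le0 leNgt; apply/negP => v0.
have [Y [_ /(_ u Vu) Yu]] := form_closure u XS v0.
by rewrite Yu subr0 ltxx.
Qed.

(** The curve (V + t G) (V + t G)^T stays in the cone; its difference quotient at t misses the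
    direction by t G G^T. *)
Lemma tangent_cone_image_sub N : tangent_mx V N -> tangent_cone C (B (V *m V^T)) (B N).
Proof.
move=> /tangent_mxE[G ->]; apply/closure_fnormP => e e0.
pose f := fnorm (B (G *m G^T)).
have f0 : 0 < f + 1 by rewrite ltr_wpDl ?fnorm_ge0.
pose t := e / (f + 1); have t0 : 0 < t by rewrite divr_gt0.
pose Y := (V + t *: G) *m (V + t *: G)^T.
exists (t^-1 *: (B Y - B (V *m V^T))).
  exists 1%N, (fun=> t^-1), (fun=> B Y - B (V *m V^T)); split=> // [_|_|].
  - by rewrite invr_ge0 ltW.
  - by exists (B Y) => //; exists Y => //; exact: psd_cone_gram.
  - by rewrite big_ord1.
have YE : Y = V *m V^T + t *: (V *m G^T + G *m V^T) + t ^+ 2 *: (G *m G^T).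
  have YT : (V + t *: G)^T = V^T + t *: G^T by rewrite linearD linearZ.
  rewrite /Y YT mulmxDl !mulmxDr -!scalemxAr -!scalemxAl scalerA -expr2.
  by rewrite scalerDr !addrA.
rewrite -trace_mapB -trace_mapZ -trace_mapB.
have -> : V *m G^T + G *m V^T - t^-1 *: (Y - V *m V^T) = (- t) *: (G *m G^T).
  rewrite YE -(addrA (V *m V^T)) (addrC (V *m V^T)) addrK scalerDr !scalerA mulVf ?gt_eqF // scale1r.
  by rewrite opprD addrA subrr add0r expr2 mulKf ?gt_eqF // scaleNr.
rewrite trace_mapZ fnormZ normrN gtr0_norm // -/f.
by rewrite /t mulrAC ltr_pdivrMr // ltr_pM2l // ltrDl.
Qed.

(** Before closure every direction lifts to a matrix: V V^T vanishes on the complement of the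
    columns of V, where each Z - V V^T is therefore psd. *)
Lemma conic_hull_image y : conic_hull [set z - B (V *m V^T) | z in C] y ->
  exists M, [/\ M^T = M, psd_on_perp V M & y = B M].
Proof.
move=> [m [a [s [a0 sC ->]]]].
have /choice[Z hZ] : forall i, exists Z, psd_cone d Z /\ s i = B Z - B (V *m V^T).
  by move=> i; have [_ [Z Zp <-] <-] := sC i; exists Z.
exists (\sum_i a i *: (Z i - V *m V^T)); split.
- rewrite linear_sum; apply: eq_bigr => i _ /=; have [[ZT _] _] := hZ i.
  by rewrite linearZ linearB /= ZT trmx_mul trmxK.
- move=> u Vu; rewrite mulmx_sumr mulmx_suml summxE; apply: sumr_ge0 => i _.
  have uV : u^T *m (V *m V^T) *m u = 0 by rewrite -!mulmxA Vu !mulmx0.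
  have [[_ Zp] _] := hZ i.
  by rewrite quad_formZ mulr_ge0 // mulmxBr mulmxBl uV subr0.
rewrite trace_map_sum; apply: eq_bigr => i _; rewrite trace_mapZ trace_mapB.
by have [_ ->] := hZ i.
Qed.

Lemma convex_tangent_space_image :
  convex_tangent_space C (B (V *m V^T)) = B @` tangent_mx V.
Proof.
apply/seteqP; split=> [z|_ [N NV <-]]; last first.
  split; first exact: tangent_cone_image_sub.
  exists (B (- N)); first exact: tangent_cone_image_sub (tangent_mxN NV).
  by rewrite trace_mapN opprK.
move=> [/closure_fnormP zT [y /closure_fnormP yT yz]].
apply: closed_tangent_image; apply/closure_fnormP => e e0.
have [K1 K10 BK] := trace_map_bound.
have [P [C0 [PVC PT PP PV _]]] := projection_exists V.
pose Q := 1%:M - P; have QQ : Q *m Q = Q.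
  by rewrite /Q mulmxBl mul1mx mulmxBr mulmx1 PP subrr subr0.
(* Chosen so that an error dl in both approximations yields dl K2 = e in the end. *)
pose K2 := 1 + K1 * (fnorm Q * (K * 2)).
have K20 : 0 < K2 by rewrite ltr_pwDl // !mulr_ge0 ?fnorm_ge0.
pose dl := e / K2; have dl0 : 0 < dl by rewrite divr_gt0.
have [_ /conic_hull_image[M [MT Mp ->]] zM] := zT dl dl0.
have [_ /conic_hull_image[M' [MT' Mp' ->]] yM'] := yT dl dl0.
pose S := M + M'.
have BS : fnorm (B S) <= 2 * dl.
  have -> : B S = - ((z - B M) + (y - B M')).
    by rewrite /S trace_mapD -yz addrACA addNr add0r -opprD opprK.
  rewrite fnormN; apply: le_trans (fnormD _ _) _; lra.
have ST : S^T = S by rewrite /S linearD /= MT MT'.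
have Sp : psd_on_perp V S.
  by move=> u Vu; rewrite /S mulmxDr mulmxDl mxE addr_ge0 ?Mp ?Mp'.
have S2 : fnorm S <= K * (2 * dl) by apply: le_trans (BV ST Sp) _; rewrite ler_wpM2l.
have psd1 := compression_psd PT PV MT Mp; have psd2 := compression_psd PT PV MT' Mp'.
rewrite -/Q in psd1 psd2; set T1 := Q *m M *m Q in psd1.
(* Both compressions are psd, so the trace of [T1] is at most that of Q S Q, hence at most |Q|
   |S|. *)
have T1S : fnorm T1 <= fnorm Q * (K * (2 * dl)).
  apply: le_trans (psd_fnorm_le psd1) _.
  apply: le_trans (_ : \tr (Q *m S *m Q) <= _).
    have -> : Q *m S *m Q = T1 + Q *m M' *m Q by rewrite (mulmxDr Q M) (mulmxDl (Q *m M)).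
    by rewrite mxtraceD lerDl psd_trace_ge0.
  rewrite mxtrace_mulC mulmxA QQ.
  have := mxdot_le Q^T S; rewrite /mxdot trmxK fnorm_tr => /(le_trans (ler_norm _)).
  move/le_trans; apply; rewrite ler_wpM2l ?fnorm_ge0 //.
exists (B (M - T1)).
  exists (M - T1) => //; split.
    have [T1T _] := psd1; by rewrite linearB /= MT T1T.
  move=> u Vu; have Qu : Q *m u = u.
    by rewrite /Q mulmxBl mul1mx -PT PVC trmx_mul -mulmxA Vu mulmx0 subr0.
  have QT : Q^T = Q by rewrite /Q linearB /= trmx1 PT.
  have uQ : u^T *m Q = u^T by rewrite -{1}QT -trmx_mul Qu.
  have -> : u^T *m (M - T1) *m u = 0; last by rewrite mxE.
  by rewrite mulmxBr mulmxBl /T1 !mulmxA uQ -(mulmxA _ Q u) Qu subrr.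
have -> : z - B (M - T1) = (z - B M) + B T1 by rewrite trace_mapB opprB addrA addrAC.
apply: le_lt_trans (fnormD _ _) _.
apply: lt_le_trans (_ : dl + K1 * (fnorm Q * (K * (2 * dl))) <= _).
  apply: ltr_leD => //; apply: le_trans (BK _) _; exact: ler_wpM2l.
rewrite le_eqVlt; apply/orP; left; apply/eqP.
have -> : dl + K1 * (fnorm Q * (K * (2 * dl))) = dl * K2 by rewrite /K2; ring.
by rewrite /dl divfK // gt_eqF.
Qed.

End Tangent.

(** A matrix psd on the complement of one v i is psd on the smaller complement of V, so a single K
    serves for the sum and for every summand. Splitting V G^T + G V^T by columns then decomposes the
    tangent space. *)
Lemma terracini_convex_psd_image (k : nat) (K : R) : 0 <= K ->
  (forall (V : 'M[R]_(d, k)) (M : 'M[R]_d), M^T = M -> psd_on_perp V M ->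
     fnorm M <= K * fnorm (B M)) ->
  terracini_convex k C.
Proof.
move=> K0 BV; split; [exact: closed_psd_image|exact: convex_cone_psd_image|exact: pointed_psd_image|].
move=> x /(_ _)/extreme_ray_rank1 xv.
have /choice[v vx] := xv.
pose V : 'M[R]_(d, k) := \matrix_(a, i) v i a 0.
have colV i : col i V = v i by apply/colP => a; rewrite !mxE.
have Vu u i : V^T *m u = 0 -> (v i)^T *m u = 0 :> 'M[R]_1.
  by move=> Vu0; rewrite -colV tr_col -row_mul Vu0 row0.
have tangV i N : tangent_mx (v i) N -> tangent_mx V N.
  by move=> [NT N0]; split=> // u /(Vu u i)/N0.
have xE : \sum_i x i = B (V *m V^T).
  rewrite mul_tr_sum_col trace_map_sum; apply: eq_bigr => i _.
  by rewrite colV vx.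
rewrite xE (convex_tangent_space_image K0 (BV V)).
have Lx i : convex_tangent_space C (x i) = B @` tangent_mx (v i).
  rewrite vx (@convex_tangent_space_image _ (v i) K K0) // => M MT Mp.
  by apply: (BV V) => // u /(Vu u i); exact: Mp.
apply/seteqP; split=> [_ [N /tangent_mxE[G ->] <-]|_ [w wL <-]].
  exists (fun i => B (v i *m (col i G)^T + col i G *m (v i)^T)).
    by move=> i; rewrite Lx; eexists; last by []; apply/tangent_mxE; exists (col i G).
  rewrite -trace_map_sum; congr B; rewrite big_split /= !mul_tr_sum_col.
  by congr (_ + _); apply: eq_bigr => i _; rewrite colV.
have /choice[N wN] : forall i, exists N, tangent_mx (v i) N /\ w i = B N.
  by move=> i; have := wL i; rewrite Lx => -[N NV <-]; exists N.
exists (\sum_i N i).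
  elim/big_ind: _ => [||i _]; [exact: tangent_mx0|exact: tangent_mxD|].
  by apply: (tangV i); have [] := wN i.
by rewrite trace_map_sum; apply: eq_bigr => i _; have [_ ->] := wN i.
Qed.

End TraceMap.

(** * Choice of the constants *)

Theorem theorem4p8 (R : realType) :
  exists (c1 c2 : R) (c3 : R -> R),
    [/\ 0 < c1, 0 < c2, forall eps : R, 0 < eps < 1 / 2 -> 0 < c3 eps
      & forall (eps : R) (n d : nat),
          0 < eps < 1 / 2 ->
          (0 < n)%N ->
          n%:R <= (1 / 2 - eps) * 'C(d.+1, 2)%:R ->
        forall (disp : measure_display) (T : measurableType disp)
          (P : probability T R) (A : 'I_n -> random_matrix P d),
          independent P (fun i => sigma_matrix (A i)) ->
          (forall i, gaussian_matrix (1 / n%:R) (A i)) ->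
          probability_gt P
            [set w | terracini_convex (Num.truncn (c1 * n%:R / d%:R))
                       (trace_map (fun i => sample (A i) w) @` psd_cone d)]
            (1 - 2 * expR (- c2 * n%:R) - expR (- c3 eps * n%:R))].
Proof.
have [a [b [c [kappa [a0 b0 c0 kappa0 iso]]]]] := random_isometry (R := R).
(* With m = mu k samples the condition of [almost_psd_lower_bound] holds. *)
pose mu := (Num.truncn (4 * (a ^+ 2 + b ^+ 2) / a ^+ 2)).+1.
have a2 : 0 < a ^+ 2 by rewrite exprn_gt0.
have mu_big : 4 * (a ^+ 2 + b ^+ 2) <= a ^+ 2 * mu%:R.
  by rewrite [leRHS]mulrC -ler_pdivrMr //; exact/ltW/truncnS_gt.
clearbody mu.
have mu2 : 0 < mu%:R + 2 :> R by rewrite ltr_wpDl.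
(* The isometry is used at rank (mu + 2) k, and c1 ensures d (mu + 2) k <= kappa n. *)
exists (kappa / (mu%:R + 2)), c, (fun=> 1); split=> //; first by rewrite divr_gt0.
move=> eps n d eps01 n0 nd disp T P A indA gaussA.
set k := Num.truncn _.
have d0 : (0 < d)%N.
  rewrite lt0n; apply: contraTneq nd => ->.
  by rewrite bin_small // mulr0 -ltNge ltr0n.
have kle : k%:R <= kappa / (mu%:R + 2) * n%:R / d%:R.
  rewrite /k; set x := _ / d%:R; have x0 : 0 <= x.
    by rewrite divr_ge0 // mulr_ge0 // divr_ge0 // ltW.
  by have /andP[] := truncn_itv x0.
have ltE (E : \bar R) : ((1 - 2 * expR (- c * n%:R))%:E <= E)%E ->
    ((1 - 2 * expR (- c * n%:R) - expR (- 1 * n%:R))%:E < E)%E.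
  by apply: lt_le_trans; rewrite lte_fin ltrBlDr ltrDl expR_gt0.
(* For k = 0 the matrix V has no columns, [psd_on_perp] means psd, and the trace coordinate gives K
   = 1 at every sample point. *)
have [k0|k0] := posnP k.
  exists setT; split=> //; last first.
    apply: ltE; rewrite probability_setT lee_fin gerBl.
    by rewrite mulr_ge0 // expR_ge0.
  move=> w _ /=; rewrite k0; apply: (terracini_convex_psd_image (K := 1)) => // V M MT Mp.
  rewrite mul1r; apply: psd_fnorm_le_trace_map; split=> // u.
  by apply: Mp; exact: flatmx0.
have [|E [mE PE isoE]] := iso n d (k + k + mu * k)%N n0 d0 _ disp T P A indA gaussA.
  rewrite ler_pdivlMr ?ltr0n // in kle.
  rewrite natrM !natrD natrM.
  have -> : k%:R + k%:R + mu%:R * k%:R = (mu%:R + 2) * k%:R :> R by ring.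
  rewrite mulrCA -ler_pdivlMl // mulrC; apply: le_trans kle _.
  by rewrite mulrA [X in X * _]mulrC.
exists E; split=> //; last exact: ltE.
move=> w Ew /=.
(* From a^2 |M|^2 / 2 <= |calA M|^2 + a^2 (tr M)^2 <= (1 + a^2) (|calA M|^2 + (tr M)^2). *)
pose K := Num.sqrt (2 * (1 + a ^+ 2) / a ^+ 2).
have K20 : 0 <= 2 * (1 + a ^+ 2) / a ^+ 2 by rewrite divr_ge0 ?(ltW a2) // mulr_ge0 // addr_ge0 // ltW.
apply: (terracini_convex_psd_image (K := K)) => [|V M MT Mp]; first exact: sqrtr_ge0.
rewrite -(@ler_pXn2r _ 2) ?nnegrE ?mulr_ge0 ?fnorm_ge0 ?sqrtr_ge0 //.
rewrite exprMn (sqr_sqrtr K20) sqr_fnorm_trace_map.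
have mk : 4 * (a ^+ 2 + b ^+ 2) * k%:R <= a ^+ 2 * (mu * k)%:R.
  by rewrite natrM mulrA ler_wpM2r.
have := almost_psd_lower_bound a0 k0 mk (isoE w Ew) MT Mp.
set f := fnorm (trace_row _ M) => h.
rewrite mulrAC ler_pdivlMr // mulrC.
have := sqr_ge0 f; have := sqr_ge0 (\tr M); have := sqr_ge0 (fnorm M).
nra.
Qed.
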